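(* Let $\alpha$ be a special Pisot unit, $\beta=\alpha/(\alpha-1)$, such that $\alpha=\beta^q$ holds for an integer $q\ge2$ (i.e. $q\in\{2,3,4,5\}$). Let $\theta'_q$ be the following substitution. If $q$ is odd, $\mathcal{A}=\{0,\dots,2q-1\}$ and $$k\mapsto q+k+1\ (0\le k\le q-2),\quad (q-1)\mapsto 0\,(2q-1),\quad q+k\mapsto k+1\ (0\le k\le q-2),\quad (2q-1)\mapsto(q-1)\,q.$$ If $q$ is even, $\mathcal{A}=\{0,\dots,q-1\}$ and $$k\mapsto k+2\ (0\le k\le q-3),\quad (q-2)\mapsto 0\,(q-1),\quad (q-1)\mapsto 0\,(q-1)\,1$$ (in particular $\theta'_2:0\mapsto01,\ 1\mapsto011$). Then $\theta'_q$ is a primitive unimodular Pisot substitution. Its dominant root is $\beta$ if $q$ is odd, and $\beta^2$ if $q$ is even. Furthermore $\mathcal{R}_{\theta'_q}(k)\cong X_k$ for each $k\in\mathcal{A}$, where for odd $q$ $$X_k=\begin{cases}\Psi[\alpha\beta^k](\mathcal{F}_\alpha), & k\in\{0,2,\dots,q-3\};\\ \psi(\beta^k)-\Psi[\alpha\beta^k](\mathcal{F}_\alpha), & k\in\{1,3,\dots,q-2\};\\ \Psi[\beta^{q-1}](\mathcal{F}_\alpha), & k=q-1;\\ \psi(\beta^{k-q})-\Psi[\alpha\beta^{k-q}](\mathcal{F}_\alpha), & k\in\{q,q+2,\dots,2q-3\};\\ \Psi[\alpha\beta^{k-q}](\mathcal{F}_\alpha), & k\in\{q+1,q+3,\dots,2q-2\};\\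 \psi(\beta^{q-1})-\Psi[\beta^{q-1}](\mathcal{F}_\alpha), & k=2q-1;\end{cases}$$ and for even $q$ $$X_k=\begin{cases}\Psi[\alpha\beta^k](\mathcal{F}_\alpha), & k\in\{0,2,\dots,q-2\};\\ \psi(\beta^k)-\Psi[\alpha\beta^k](\mathcal{F}_\alpha), & k\in\{1,3,\dots,q-3\};\\ \psi(\beta^{q-1})-\Psi[\beta^{q-1}](\mathcal{F}_\alpha), & k=q-1.\end{cases}$$
   Context: Tent-tiles. A Pisot number is an algebraic integer that is a real number $>1$ whose other Galois conjugates have modulus $<1$. A special Pisot unit is a Pisot number $\alpha$ that is an algebraic unit and for which $\beta=\alpha/(\alpha-1)$ is also a Pisot number. Let $d+1$ be the degree of $\alpha$, with further real conjugates $\alpha^{(1)},\dots,\alpha^{(r)}$ and non-real conjugates $\alpha^{(r+1)},\overline{\alpha^{(r+1)}},\dots,\alpha^{(r+s)},\overline{\alpha^{(r+s)}}$. Put $\mathbb{K}_\alpha=\mathbb{R}^r\times\mathbb{C}^s$; for $z\in\mathbb{Q}(\alpha)$ let $z^{(k)}$ be its image under $\alpha\mapsto\alpha^{(k)}$, $\psi(z)=(z^{(1)},\dots,z^{(r+s)})^T$, and $\Psi[z](x_1,\dots,x_{r+s})=(z^{(1)}x_1,\dots,z^{(r+s)}x_{r+s})^T$. Put $f_L(x)=\Psi[\alpha](x)$, $f_R(x)=\Psi[\beta](\psi(1)-x)$. The tent-tile $\mathcal{F}_\alpha$ is the unique non-empty compact set with $\mathcal{F}_\alpha=f_L(\mathcal{F}_\alpha)\cup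 f_R(\mathcal{F}_\alpha)$. For a set $F$, $c-F=\{c-y:y\in F\}$. Index sets such as $\{1,3,\dots,q-3\}$ are empty when the last entry is smaller than the first. Rauzy fractals. Let $\mathcal{A}=\{0,\dots,m\}$ and $\mathcal{A}^*$ the free monoid of finite words over $\mathcal{A}$ (empty word $\varepsilon$). For $W\in\mathcal{A}^*$ let $\ell(W)=(|W|_0,\dots,|W|_m)^T$ count letter occurrences. A substitution $\zeta$ is a non-erasing endomorphism of $\mathcal{A}^*$; its incidence matrix $M_\zeta$ has columns $\ell(\zeta(0)),\dots,\ell(\zeta(m))$. It is primitive if some power $\zeta^k$ ($k\ge1$) has all entries of $\ell(\zeta^k(a))$ positive for every $a\in\mathcal{A}$. For primitive $\zeta$, the dominant root $\lambda$ is the Perron–Frobenius eigenvalue of $M_\zeta$; $\zeta$ is unimodular if $\det M_\zeta=\pm1$ and Pisot if $\lambda$ is a Pisot number. Let $\nu$ be a left eigenvector of $M_\zeta$ for $\lambda$ with strictly positive entries in $\mathbb{Q}(\lambda)$. With the conjugates of $\lambda$ different from $\lambda$ being real $\lambda^{(1)},\dots,\lambda^{(r)}$ and non-real $\lambda^{(r+1)},\overline{\lambda^{(r+1)}},\dots,\lambda^{(r+s)},\overline{\lambda^{(r+s)}}$, put $\mathbb{K}_\zeta=\mathbb{R}^r\times\mathbb{C}^s$, $\pi(z)=(z^{(1)},\dots,z^{(r+s)})^T$ for $z\in\mathbb{Q}(\lambda)$ (images under $\lambda\mapsto\lambda^{(k)}$), $h(x_1,\dots,x_{r+s})=(\lambda^{(1)}x_1,\dots,\lambda^{(r+s)}x_{r+s})^T$,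 and for $U\in\mathcal{A}^*$, $g_U(x)=\pi(\langle\nu,\ell(U)\rangle)+h(x)$. The sets $\mathcal{R}_\zeta(a)$, $a\in\mathcal{A}$, are the unique non-empty compact subsets of $\mathbb{K}_\zeta$ with $$\mathcal{R}_\zeta(a)=\bigcup_{(b,U,V):\ \zeta(b)=UaV} g_U(\mathcal{R}_\zeta(b))\qquad(a\in\mathcal{A},\ b\in\mathcal{A},\ U,V\in\mathcal{A}^* ).$$ They are determined up to a linear isomorphism (depending on the choice of $\nu$ and of the ordering of conjugates). Here ''$\mathcal{R}_\zeta(k)\cong X_k$ for each $k$'' means: there is a linear bijection $\Phi:\mathbb{K}_\alpha\to\mathbb{K}_\zeta$, the same for all $k\in\mathcal{A}$, with $\mathcal{R}_\zeta(k)=\Phi(X_k)$. *)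

(* Defs.v *)
From HB Require Import structures.
From mathcomp Require Import all_boot all_order all_algebra.
From mathcomp Require Import complex.
From mathcomp Require Import all_classical all_reals all_analysis.

Set Implicit Arguments.
Unset Strict Implicit.
Unset Printing Implicit Defensive.

Import Order.TTheory GRing.Theory Num.Theory.
Import numFieldNormedType.Exports.

Local Open Scope classical_set_scope.
Local Open Scope complex_scope.
Local Open Scope ring_scope.

Definition algebraic_integer (R : realType) (x : R) : Prop :=
  integralOver (intr : int -> R) x.

Definition algebraic_unit (R : realType) (x : R) : Prop :=
  [/\ x != 0, algebraic_integer x & algebraic_integer x^-1].

Definition ratpoly (L : unitRingType) (p : {poly rat}) : {poly L} :=
  map_poly ratr p.

Definition is_minpoly (R : realType) (x : R) (p : {poly rat}) : Prop :=
  [/\ p \is monic, irreducible_poly p & root (ratpoly R p) x].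

Definition galois_conjugates (R : realType) (x : R) : set R[i] :=
  [set y | exists2 p, is_minpoly x p & root (ratpoly R[i] p) y].

Definition pisot (R : realType) (x : R) : Prop :=
  [/\ algebraic_integer x, 1 < x &
      forall y, galois_conjugates x y -> y != x%:C -> `|y| < 1].

Definition special_pisot_unit (R : realType) (alpha : R) : Prop :=
  [/\ pisot alpha, algebraic_unit alpha & pisot (alpha / (alpha - 1))].

(* For algebraic x this is the field Q(x). *)
Definition number_field (R : realType) (x : R) : set R :=
  [set z | exists p, z = (ratpoly R p).[x]].

(* The image of z in Q(x) under the field embedding that sends x to its
   conjugate y; it does not depend on the polynomial chosen to write z.
   The value is irrelevant for z outside Q(x). *)
Definition embedding (R : realType) (L : unitRingType) (x : R) (y : L) (z : R)
    : L :=
  (ratpoly L (xget 0 [set p | z = (ratpoly R p).[x]])).[y].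

(* R[i] with the topology given by the complex modulus. *)
HB.instance Definition _ (R : realType) := NormedModule.copy R[i] (R[i]^o).

Definition Kspace (R : realType) (r s : nat) : Type :=
  ('rV[R]_r * 'rV[R[i]]_s)%type.

HB.instance Definition _ (R : realType) r s :=
  GRing.Zmodule.on (Kspace R r s).
HB.instance Definition _ (R : realType) r s :=
  Uniform.on (Kspace R r s).

(* Kspace is a real vector space: C^s is not regarded over C here. *)
Definition Kscale (R : realType) r s (a : R) (x : Kspace R r s)
    : Kspace R r s := (a *: x.1, a%:C *: x.2).

Lemma KscaleA (R : realType) r s (a b : R) (x : Kspace R r s) :
  Kscale a (Kscale b x) = Kscale (a * b) x.
Proof. by rewrite /Kscale /= !scalerA rmorphM. Qed.

Lemma Kscale1 (R : realType) r s : left_id 1 (@Kscale R r s).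
Proof. by case=> x y; rewrite /Kscale /= !scale1r. Qed.

Lemma KscaleDr (R : realType) r s : right_distributive (@Kscale R r s) +%R.
Proof. by move=> a x y; rewrite /Kscale /= !scalerDr. Qed.

Lemma KscaleDl (R : realType) r s (x : Kspace R r s) :
  {morph (@Kscale R r s)^~ x : a b / a + b}.
Proof. by move=> a b; rewrite /Kscale rmorphD /= !scalerDl. Qed.

HB.instance Definition _ (R : realType) r s :=
  GRing.Zmodule_isLmodule.Build R (Kspace R r s)
    (@KscaleA R r s) (@Kscale1 R r s) (@KscaleDr R r s) (@KscaleDl R r s).

(* Coordinatewise product; multiplying by psi z gives Psi[z]. *)
Definition Kmul (R : realType) r s (x y : Kspace R r s) : Kspace R r s :=
  (\row_i (x.1 0 i * y.1 0 i), \row_j (x.2 0 j * y.2 0 j)).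

(* c lists the conjugates of x other than x itself: c.1 the real ones, and c.2
   one out of each pair of complex conjugate non-real ones. *)
Definition conjugate_system (R : realType) r s (x : R) (c : Kspace R r s)
    : Prop :=
  let others := [seq (c.1 0 i)%:C | i : 'I_r]
    ++ [seq c.2 0 j | j : 'I_s] ++ [seq (c.2 0 j)^* | j : 'I_s] in
  [/\ uniq others,
      forall y : R[i], y \in others <-> galois_conjugates x y /\ y != x%:C
    & forall j, complex.Im (c.2 0 j) != 0].

Definition psi (R : realType) r s (x : R) (c : Kspace R r s) (z : R)
    : Kspace R r s :=
  (\row_i embedding x (c.1 0 i) z, \row_j embedding x (c.2 0 j) z).

Definition Psi (R : realType) r s (x : R) (c : Kspace R r s) (z : R)
    (y : Kspace R r s) : Kspace R r s :=
  Kmul (psi x c z) y.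

Definition minus_set (R : realType) r s (v : Kspace R r s)
    (F : set (Kspace R r s)) : set (Kspace R r s) :=
  [set v - y | y in F].

Definition tent_tile (R : realType) r s (alpha : R) (c : Kspace R r s)
    (F : set (Kspace R r s)) : Prop :=
  let beta := alpha / (alpha - 1) in
  let fL x := Psi alpha c alpha x in
  let fR x := Psi alpha c beta (psi alpha c 1 - x) in
  [/\ F !=set0, compact F & F = fL @` F `|` fR @` F].

(* A map from letters to words, standing for the endomorphism of the free
   monoid that extends it. *)
Definition letter_map (m : nat) : Type := 'I_m.+1 -> seq 'I_m.+1.

Definition subst_word m (zeta : letter_map m) (W : seq 'I_m.+1)
    : seq 'I_m.+1 :=
  flatten [seq zeta a | a <- W].

Definition substitution m (zeta : letter_map m) : Prop :=
  forall a, zeta a != [::].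

Definition abelianization m (W : seq 'I_m.+1) : 'cV[int]_m.+1 :=
  \col_a (count_mem a W)%:Z.

Definition incidence_mx m (zeta : letter_map m) : 'M[int]_m.+1 :=
  \matrix_(a, b) abelianization (zeta b) a 0.

Definition primitive_subst m (zeta : letter_map m) : Prop :=
  exists2 k, (0 < k)%N &
    forall a b, 0 < abelianization (iter k (subst_word zeta) [:: a]) b 0.

Definition unimodular_subst m (zeta : letter_map m) : Prop :=
  \det (incidence_mx zeta) = 1 \/ \det (incidence_mx zeta) = -1.

(* The Perron-Frobenius eigenvalue of the incidence matrix. *)
Definition dominant_root (R : realType) m (zeta : letter_map m) (lam : R)
    : Prop :=
  [/\ 0 < lam, eigenvalue (map_mx intr (incidence_mx zeta)) lam &
      forall mu : R[i], eigenvalue (map_mx intr (incidence_mx zeta)) mu ->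
        mu != lam%:C -> `|mu| < lam%:C].

Definition pisot_subst (R : realType) m (zeta : letter_map m) : Prop :=
  exists2 lam : R, dominant_root zeta lam & pisot lam.

Definition left_PF_vector (R : realType) m (zeta : letter_map m) (lam : R)
    (nu : 'rV[R]_m.+1) : Prop :=
  [/\ nu *m map_mx intr (incidence_mx zeta) = lam *: nu,
      forall a, 0 < nu 0 a & forall a, number_field lam (nu 0 a)].

Definition rauzy_map (R : realType) m r s (lam : R) (c : Kspace R r s)
    (nu : 'rV[R]_m.+1) (U : seq 'I_m.+1) (x : Kspace R r s) : Kspace R r s :=
  psi lam c ((nu *m map_mx intr (abelianization U)) 0 0) + Kmul c x.

(* A triple t = (b, U, V) with zeta b = U a V. *)
Definition rauzy_fractal (R : realType) m r s (zeta : letter_map m) (lam : R)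
    (c : Kspace R r s) (nu : 'rV[R]_m.+1) (Rz : 'I_m.+1 -> set (Kspace R r s))
    : Prop :=
  forall a, [/\ Rz a !=set0, compact (Rz a) &
    Rz a = \bigcup_(t in [set t : 'I_m.+1 * seq 'I_m.+1 * seq 'I_m.+1 |
                          zeta t.1.1 = t.1.2 ++ a :: t.2])
            (rauzy_map lam c nu t.1.2 @` Rz t.1.1)].

(* theta q is over the letters 0, ..., theta_max q. *)
Definition theta_max (q : nat) : nat := if odd q then q.*2.-1 else q.-1.

Definition theta_odd (q k : nat) : seq nat :=
  if (k <= q - 2)%N then [:: q + k + 1]%N
  else if k == (q - 1)%N then [:: 0; 2 * q - 1]%N
  else if (k <= q + (q - 2))%N then [:: (k - q) + 1]%N
  else [:: q - 1; q]%N.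

(* k + 3 <= q rather than k <= q - 3, which truncated subtraction would make
   true at q = 2, k = 0. *)
Definition theta_even (q k : nat) : seq nat :=
  if (k + 3 <= q)%N then [:: k + 2]%N
  else if k == (q - 2)%N then [:: 0; q - 1]%N
  else [:: 0; q - 1; 1]%N.

Definition theta (q : nat) : letter_map (theta_max q) := fun k =>
  [seq inord j | j <- (if odd q then theta_odd else theta_even) q k].
Arguments theta : clear implicits.

Definition tile_odd (R : realType) r s (alpha : R) (c : Kspace R r s)
    (F : set (Kspace R r s)) (q k : nat) : set (Kspace R r s) :=
  let beta := alpha / (alpha - 1) in
  let psi_ := psi alpha c in
  let Psi_ := Psi alpha c in
  if (k <= q - 2)%N then
    if odd k then
      minus_set (psi_ (beta ^+ k)) (Psi_ (alpha * beta ^+ k) @` F)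
    else Psi_ (alpha * beta ^+ k) @` F
  else if k == (q - 1)%N then Psi_ (beta ^+ (q - 1)) @` F
  else if (k <= 2 * q - 2)%N then
    if odd (k - q) then Psi_ (alpha * beta ^+ (k - q)) @` F
    else minus_set (psi_ (beta ^+ (k - q)))
           (Psi_ (alpha * beta ^+ (k - q)) @` F)
  else minus_set (psi_ (beta ^+ (q - 1))) (Psi_ (beta ^+ (q - 1)) @` F).

Definition tile_even (R : realType) r s (alpha : R) (c : Kspace R r s)
    (F : set (Kspace R r s)) (q k : nat) : set (Kspace R r s) :=
  let beta := alpha / (alpha - 1) in
  let psi_ := psi alpha c in
  let Psi_ := Psi alpha c in
  if (k <= q - 2)%N then
    if odd k then
      minus_set (psi_ (beta ^+ k)) (Psi_ (alpha * beta ^+ k) @` F)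
    else Psi_ (alpha * beta ^+ k) @` F
  else minus_set (psi_ (beta ^+ (q - 1))) (Psi_ (beta ^+ (q - 1)) @` F).

Definition tile (R : realType) r s (alpha : R) (c : Kspace R r s)
    (F : set (Kspace R r s)) (q k : nat) : set (Kspace R r s) :=
  if odd q then tile_odd alpha c F q k else tile_even alpha c F q k.

(* Main.v *)
(** Since [1 / alpha + 1 / beta = 1], the relation [alpha = beta ^+ q] gives
    [beta ^+ q = beta ^+ (q - 1) + 1].  Up to scaling, the left eigenvector of
    the incidence matrix assigns [beta ^+ k] to the letters [k] and [q + k].

    Spectrum: a left eigenvector for [mu] forces [z ^+ (q - 1) * (z - 1) = e]
    with [`|e| = 1], where [z = mu] or [z = - mu] for odd [q] and [z ^+ 2 = mu]
    for even [q].  Comparing moduli with [beta ^+ (q - 1) * (beta - 1) = 1]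
    gives [`|z| < beta] or [z = beta].

    Tiles: with minus that eigenvector, the equations of the Rauzy fractal hold
    for the tiles [X_k]; each of them is a power of [beta] times
    [F = alpha F `|` beta (1 - F)], or a consequence of
    [beta ^+ q = beta ^+ (q - 1) + 1].  The equations have only one solution in
    nonempty compact sets because multiplication by the conjugates of the
    dominant root [lam] is a contraction.  Finally [alpha] and [lam] generate
    the same field, so their conjugates correspond to each other; this
    identifies [K_alpha] with [K_zeta], and multiplication by the image of
    minus the first entry of [nu] accounts for the choice of [nu]. *)

Require Import Defs.
From HB Require Import structures.
From mathcomp Require Import all_boot all_order all_algebra.
From mathcomp Require Import complex.
From mathcomp Require Import all_classical all_reals all_analysis.
From mathcomp Require Import ring lra zify.

Import Order.TTheory GRing.Theory Num.Theory.
Import numFieldNormedType.Exports.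

Local Open Scope classical_set_scope.
Local Open Scope ring_scope.

Set Implicit Arguments.
Unset Strict Implicit.
Unset Printing Implicit Defensive.

(** * Conjugates and the field generated by an algebraic number *)

Section Conjugates.
Local Open Scope complex_scope.
Variable R : realType.
Implicit Types (x z : R) (y : R[i]) (p f g : {poly rat}).

Definition evalq (L : fieldType) (y : L) p : L := (ratpoly L p).[y].

Lemma evalqD (L : numFieldType) (y : L) f g :
  evalq y (f + g) = evalq y f + evalq y g.
Proof. by rewrite /evalq /ratpoly rmorphD hornerD. Qed.

Lemma evalqB (L : numFieldType) (y : L) f g :
  evalq y (f - g) = evalq y f - evalq y g.
Proof. by rewrite /evalq /ratpoly rmorphB hornerD hornerN. Qed.

Lemma evalqM (L : numFieldType) (y : L) f g :
  evalq y (f * g) = evalq y f * evalq y g.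
Proof. by rewrite /evalq /ratpoly rmorphM hornerM. Qed.

Lemma evalqC (L : numFieldType) (y : L) (a : rat) :
  evalq y a%:P = ratr a.
Proof. by rewrite /evalq /ratpoly map_polyC hornerC. Qed.

Lemma evalq1 (L : numFieldType) (y : L) : evalq y 1 = 1.
Proof. by rewrite /evalq /ratpoly rmorph1 hornerC. Qed.

Lemma evalqX (L : numFieldType) (y : L) : evalq y 'X = y.
Proof. by rewrite /evalq /ratpoly map_polyX hornerX. Qed.

Lemma evalq_comp (L : numFieldType) (y : L) f g :
  evalq y (f \Po g) = evalq (evalq y g) f.
Proof. by rewrite /evalq /ratpoly map_comp_poly horner_comp. Qed.

Lemma ratr_complex (a : rat) : ratr a = (ratr a : R)%:C :> R[i].
Proof. by rewrite fmorph_rat. Qed.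

Lemma evalq_real x f : evalq x%:C f = (evalq x f)%:C.
Proof.
rewrite /evalq -horner_map /ratpoly -map_poly_comp; congr (_.[_]).
by apply: eq_map_poly => a /=; rewrite ratr_complex.
Qed.

Lemma evalq_conjc y f : evalq y^* f = (evalq y f)^*.
Proof.
rewrite /evalq -horner_map /ratpoly -map_poly_comp; congr (_.[_]).
by apply: eq_map_poly => a /=; rewrite ratr_complex conjc_real.
Qed.

(** If [p] and [f] were coprime, a Bezout relation evaluated at the common root [y] would read 0 =
    1. So their gcd is not constant, and irreducibility makes it associate to [p]. *)
Lemma minpoly_dvdp (L : numFieldType) p f (y : L) :
  irreducible_poly p -> evalq y p = 0 -> evalq y f = 0 -> p %| f.
Proof.
move=> [sp pirr] py fy.
have /negP ncop : ~~ coprimep p f.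
  apply/negP => /Bezout_eq1_coprimepP [[u v] /= uv].
  have := evalq1 y; rewrite -uv evalqD !evalqM py fy !mulr0 addr0 => /eqP.
  by rewrite eq_sym oner_eq0.
have := pirr (gcdp p f).
rewrite dvdp_gcdl => /(_ _ isT) => H.
have /H : size (gcdp p f) != 1%N by apply/negP => h; apply: ncop.
by move=> /eqp_dvdl <-; rewrite dvdp_gcdr.
Qed.

Lemma evalq_dvdp (L : numFieldType) p f (y : L) :
  p %| f -> evalq y p = 0 -> evalq y f = 0.
Proof. by case/dvdpP => g -> py; rewrite evalqM py mulr0. Qed.

(** Both conditions amount to divisibility of [f] by the common minimal polynomial. Polynomial
    relations thus pass between conjugates in either direction. *)
Lemma conj_evalq0 x y f :
  galois_conjugates x y -> (evalq y f == 0) = (evalq x f == 0).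
Proof.
move=> [p [_ pirr /rootP px] /rootP py].
apply/eqP/eqP => h; apply: evalq_dvdp (minpoly_dvdp pirr _ h) _ => //.
Qed.

Lemma conj_evalq_eq x y f g : galois_conjugates x y ->
  evalq x f = evalq x g -> evalq y f = evalq y g.
Proof.
move=> xy fg; apply/eqP; rewrite -subr_eq0 -evalqB (conj_evalq0 _ xy).
by rewrite evalqB fg subrr.
Qed.

Definition algebraic x := exists p, is_minpoly x p.

(** Take a nonzero rational polynomial of least size that vanishes at [x] and make it monic. In a
    factorization, one factor vanishes at [x] and so has at least that size, which forces the other
    one to be constant. *)
Lemma algebraic_integer_algebraic x : algebraic_integer x -> algebraic x.
Proof.
case=> p0 p0mon /rootP p0x.
pose P n := `[< exists p, [/\ p != 0, evalq x p = 0 & size p = n] >].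
have exP : exists n, P n.
  pose p1 : {poly rat} := map_poly intr p0.
  have p1mon : p1 \is monic by rewrite monic_map.
  exists (size p1); apply/asboolP; exists p1; split=> //.
    exact: monic_neq0.
  rewrite -[RHS]p0x /evalq /ratpoly -map_poly_comp; congr (_.[_]).
  by apply: eq_map_poly => a /=; rewrite ratr_int.
(* Size arithmetic for a factorization of [p]: [a] and [b] are the sizes of the factors, [c] that of
   [p], and [k] the minimal size. *)
have aux1 (a b c k : nat) : c = k -> c = (a + b).-1 -> (0 < a)%N ->
  (0 < b)%N -> (k <= a)%N -> a = c by lia.
have aux2 (a b c k : nat) : a <> 1%N -> c = k -> c = (a + b).-1 ->
  (0 < a)%N -> (0 < b)%N -> (k <= b)%N -> False by lia.
case: (ex_minnP exP) => n /asboolP[p [p_neq0 px sp]] nmin.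
have lc_neq0 : lead_coef p != 0 by rewrite lead_coef_eq0.
exists ((lead_coef p)^-1 *: p); split.
- by rewrite monicE lead_coefZ mulVf.
- split.
    rewrite size_scale ?invr_eq0// ltnNge; apply/negP => s1.
    have := size1_polyC s1 => pC; move: px p_neq0; rewrite pC evalqC => /eqP.
    by rewrite fmorph_eq0 => /eqP ->; rewrite eqxx.
  move=> d sd; rewrite dvdpZr ?invr_eq0// => /[dup] dp /dvdpP[e pE].
  rewrite (eqp_rtrans (eqp_scale _ _)) ?invr_eq0//.
  have d0 : d != 0 by apply: contra_neq p_neq0 => d0; rewrite pE d0 mulr0.
  have e0 : e != 0 by apply: contra_neq p_neq0 => e0; rewrite pE e0 mul0r.
  have spE : size p = (size d + size e).-1 by rewrite pE size_mul// addnC.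
  have sd0 : (0 < size d)%N by rewrite size_poly_gt0.
  have se0 : (0 < size e)%N by rewrite size_poly_gt0.
  have /orP[/eqP dx|/eqP ex] : (evalq x d == 0) || (evalq x e == 0).
    by rewrite orbC -mulf_eq0 -evalqM -pE px.
  + rewrite -dvdp_size_eqp//; have := nmin (size d) => H.
    have /H : P (size d) by apply/asboolP; exists d.
    by move=> nd; apply/eqP; apply: aux1 sp spE sd0 se0 nd.
  + have := nmin (size e) => H.
    have /H : P (size e) by apply/asboolP; exists e.
    by move=> nd; case: (aux2 _ _ _ _ (elimN eqP sd) sp spE sd0 se0 nd).
- apply/rootP; rewrite -[LHS]/(evalq x _) -mul_polyC evalqM px mulr0 //.
Qed.

(** The minimal polynomial of [evalq x f], composed with [f], vanishes at [x], hence at [y]. *)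
Lemma conj_evalq x y f : algebraic (evalq x f) ->
  galois_conjugates x y -> galois_conjugates (evalq x f) (evalq y f).
Proof.
move=> [p mp] xy; exists p => //; apply/rootP.
case: mp => _ _ /rootP px.
by apply/eqP; rewrite -[_.[_]]/(evalq _ _) -evalq_comp (conj_evalq0 _ xy)
  evalq_comp [evalq _ _]px.
Qed.

(** A Bezout relation between [f] and the minimal polynomial of [x] becomes, at [x], an inverse of
    [evalq x f]. *)
Lemma evalq_inv x f : algebraic x -> evalq x f != 0 ->
  exists g, evalq x g = (evalq x f)^-1.
Proof.
move=> [p [_ [sp pirr] /rootP px]] fx.
have : coprimep p f.
  apply/negPn/negP => ncop.
  have := pirr (gcdp p f) ncop (dvdp_gcdl _ _) => /eqp_dvdl H.
  have pf : p %| f by rewrite -H dvdp_gcdr.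
  by move/eqP: fx; apply; exact: evalq_dvdp pf px.
case/Bezout_eq1_coprimepP => -[u v] /= uv.
exists v; apply: (mulIf fx); rewrite mulVf//.
have := evalq1 x; rewrite -uv evalqD !evalqM.
by rewrite [evalq x p]px mulr0 add0r.
Qed.

Lemma numfieldB x z z' :
  number_field x z -> number_field x z' -> number_field x (z - z').
Proof. by move=> [f ->] [g ->]; exists (f - g); rewrite -[RHS]/(evalq _ _) evalqB. Qed.

Lemma numfieldM x z z' :
  number_field x z -> number_field x z' -> number_field x (z * z').
Proof. by move=> [f ->] [g ->]; exists (f * g); rewrite -[RHS]/(evalq _ _) evalqM. Qed.

Lemma numfield1 x : number_field x 1.
Proof. by exists 1; rewrite -[RHS]/(evalq _ _) evalq1. Qed.

Lemma numfield_id x : number_field x x.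
Proof. by exists 'X; rewrite -[RHS]/(evalq _ _) evalqX. Qed.

Lemma numfield0 x : number_field x 0.
Proof. by rewrite -(subrr 1); apply: numfieldB; exact: numfield1. Qed.

Lemma numfieldN x z : number_field x z -> number_field x (- z).
Proof. by rewrite -[- z]add0r; apply: numfieldB; exact: numfield0. Qed.

Lemma numfield_sum x (I : Type) (l : seq I) (F : I -> R) :
  (forall i, number_field x (F i)) -> number_field x (\sum_(i <- l) F i).
Proof.
move=> xF; elim: l => [|i l IH]; first by rewrite big_nil; exact: numfield0.
by rewrite big_cons -[\sum_(_ <- _) _]opprK; apply/numfieldB/numfieldN.
Qed.

Lemma numfieldX x z n : number_field x z -> number_field x (z ^+ n).
Proof.
move=> xz; elim: n => [|n IH]; first exact: numfield1.
by rewrite exprS; exact: numfieldM.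
Qed.

Lemma numfieldV x z : algebraic x -> number_field x z -> number_field x z^-1.
Proof.
move=> ax [f ->]; rewrite -[_.[x]]/(evalq x f); have [->|f0] := eqVneq (evalq x f) 0.
  by exists 0; rewrite invr0 /ratpoly rmorph0 horner0.
by have [g gE] := evalq_inv ax f0; exists g; rewrite -[RHS]/(evalq _ _) gE.
Qed.

End Conjugates.

(** * The substitution theta *)

Section SubstitutionLetters.
Variables (m : nat) (zeta : letter_map m).
Implicit Types (a b : 'I_m.+1) (U W : seq 'I_m.+1).

Lemma sum_abelianization (L : pzRingType) (w : 'I_m.+1 -> L) U :
  \sum_a w a * (abelianization U a 0)%:~R = \sum_(a <- U) w a.
Proof.
elim: U => [|x U IH].
  by rewrite big_nil big1// => a _; rewrite mxE mulr0.
rewrite big_cons -IH (bigD1 x)//= [in RHS](bigD1 x)//= addrA; congr (_ + _).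
  rewrite !mxE /= eqxx add1n -[_.+1%:Z]/((1 + _)%N%:Z) PoszD rmorphD /=.
  by rewrite mulrDr mulr1.
by apply: eq_bigr => a ax; rewrite !mxE /= eq_sym (negbTE ax).
Qed.

Lemma mulmx_abelianization (L : pzRingType) (w : 'rV[L]_m.+1) U :
  (w *m map_mx intr (abelianization U)) 0 0 = \sum_(a <- U) w 0 a.
Proof.
by rewrite -sum_abelianization mxE; apply: eq_bigr => a _; rewrite !mxE.
Qed.

Lemma mulmx_incidence (L : pzRingType) (w : 'rV[L]_m.+1) b :
  (w *m map_mx intr (incidence_mx zeta)) 0 b = \sum_(a <- zeta b) w 0 a.
Proof.
by rewrite -sum_abelianization mxE; apply: eq_bigr => a _; rewrite !mxE.
Qed.

Lemma mem_iter_subst n U b :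
  b \in iter n (subst_word zeta) U ->
  forall V, {subset U <= V} -> b \in iter n (subst_word zeta) V.
Proof.
elim: n b => [|n IH] b; first by move=> bU V; exact.
rewrite !iterS => /flatten_mapP[a aU bz] V UV.
by apply/flatten_mapP; exists a => //; exact: IH UV.
Qed.

Lemma iter_subst_trans n k a b c :
  b \in iter n (subst_word zeta) [:: a] ->
  c \in iter k (subst_word zeta) [:: b] ->
  c \in iter (n + k) (subst_word zeta) [:: a].
Proof.
move=> ab bc; rewrite addnC iterD; apply: mem_iter_subst bc _ _.
by move=> x; rewrite inE => /eqP ->.
Qed.

(* A hub [h] with return paths of every large length makes all letters
   reachable from each other in one common number of steps. *)
Lemma primitive_hub (h : 'I_m.+1) S T : (0 < T)%N ->
  (forall a, exists2 s, (s <= S)%N & h \in iter s (subst_word zeta) [:: a]) ->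
  (forall b, exists2 s, (s <= S)%N & b \in iter s (subst_word zeta) [:: h]) ->
  (forall n, (T <= n)%N -> h \in iter n (subst_word zeta) [:: h]) ->
  primitive_subst zeta.
Proof.
move=> T0 toh fromh loop; exists (S + S + T)%N; first by lia.
move=> a b; rewrite mxE ltz_nat -has_count has_pred1.
have [s sS ah] := toh a; have [t tS hb] := fromh b.
have hh : h \in iter (S + S + T - s - t) (subst_word zeta) [:: h].
  by apply: loop; lia.
have := iter_subst_trans (iter_subst_trans ah hh) hb.
by rewrite (_ : (s + _ + t = S + S + T)%N)//; lia.
Qed.

(** The hypothesis says that the columns of the incidence matrix generate the whole lattice as an
    additive group. The matrix then has an integral right inverse, so its determinant is a unit of
    the integers. *)
Lemma unimodular_span :
  (forall P : 'cV[int]_m.+1 -> Prop,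
    (forall u v, P u -> P v -> P (u - v)) ->
    (forall b, P (\sum_(a <- zeta b) delta_mx a 0)) ->
    forall a, P (delta_mx a 0)) -> unimodular_subst zeta.
Proof.
move=> span; pose M := incidence_mx zeta.
have /choice[x xM] : forall a, exists x : 'cV_m.+1, M *m x = delta_mx a 0.
  (* The image of the matrix is closed under subtraction and contains every column. *)
  apply: (span (fun v => exists x, M *m x = v)).
  - by move=> u v [x <-] [y <-]; exists (x - y); rewrite mulmxBr.
  - move=> b; exists (delta_mx b 0); rewrite -colE; apply/matrixP => i j.
    rewrite !ord1 !mxE.
    rewrite summxE; elim: (zeta b) => [|c U IH]; first by rewrite big_nil.
    by rewrite big_cons -IH !mxE eqxx andbT /= PoszD eq_sym; case: (i == c).

have MN : M *m (\matrix_(i, j) x j i 0) = 1%:M.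
  apply/matrixP => i j; have := congr1 (fun A : 'cV_m.+1 => A i 0) (xM j).
  rewrite !mxE eqxx andbT => <-.
  by apply: eq_bigr => k _; rewrite !mxE.
have := congr1 (@determinant _ _) MN; rewrite det_mulmx det1 => detMN.
have /orP[/eqP|/eqP] : \det M \is a GRing.unit; last by right.
  by apply/unitrPr; eexists; exact: detMN.
by left.
Qed.

End SubstitutionLetters.

Section Theta.
Variable q : nat.
Hypothesis q2 : (2 <= q)%N.

(** Letters are kept as natural numbers, before [inord], so that index computations stay in
    [nat]. *)
Definition theta_word k := (if odd q then theta_odd else theta_even) q k.

Lemma theta_sizeE : (theta_max q).+1 = if odd q then (2 * q)%N else q.
Proof. by rewrite /theta_max; case: ifP => _; lia. Qed.

Lemma theta_word_lt k n : (k < (theta_max q).+1)%N ->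
  n \in theta_word k -> (n < (theta_max q).+1)%N.
Proof.
rewrite theta_sizeE /theta_word; case: ifP => oq kq.
  by rewrite /theta_odd; repeat case: ifP => ?; rewrite !inE; lia.
by rewrite /theta_even; repeat case: ifP => ?; rewrite !inE; lia.
Qed.

Lemma sum_theta (V : nmodType) (w : 'I_(theta_max q).+1 -> V) k :
  \sum_(a <- theta q k) w a = \sum_(n <- theta_word k) w (inord n).
Proof. by rewrite /theta big_map. Qed.

Lemma val_theta (k : 'I_(theta_max q).+1) :
  map val (theta q k) = theta_word k.
Proof.
rewrite /theta -map_comp -[RHS]map_id; apply/eq_in_map => n /= nk.
by rewrite inordK// (theta_word_lt _ nk).
Qed.

Lemma substitution_theta : substitution (theta q).
Proof.
move=> k; rewrite -size_eq0 /theta size_map size_eq0 /theta_odd /theta_even.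
by case: ifP => _; repeat case: ifP => ?.
Qed.

Definition reach n a b := (inord b : 'I_(theta_max q).+1)
  \in iter n (subst_word (theta q)) [:: inord a].

Lemma reach_trans n k a b c : reach n a b -> reach k b c -> reach (n + k) a c.
Proof. exact: iter_subst_trans. Qed.

Lemma reach_transE n k l a b c :
  reach n a b -> reach k b c -> l = (n + k)%N -> reach l a c.
Proof. by move=> ab bc ->; exact: reach_trans bc. Qed.

Lemma reach0 a : reach 0 a a.
Proof. by rewrite /reach inE. Qed.

Lemma reach1 a b : (a < (theta_max q).+1)%N -> b \in theta_word a -> reach 1 a b.
Proof.
move=> aN ba; rewrite /reach /= /subst_word /= cats0 /theta inordK//.
exact: map_f.
Qed.

Lemma reach_iter h k n : reach k h h -> reach (n * k) h h.
Proof.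
by move=> hh; elim: n => [|n IH]; [exact: reach0|rewrite mulSn; exact: reach_trans IH].
Qed.

Lemma primitive_hub_nat h S T : (0 < T)%N ->
  (forall a, (a < (theta_max q).+1)%N -> exists2 s, (s <= S)%N & reach s a h) ->
  (forall b, (b < (theta_max q).+1)%N -> exists2 s, (s <= S)%N & reach s h b) ->
  (forall n, (T <= n)%N -> reach n h h) ->
  primitive_subst (theta q).
Proof.
move=> T0 toh fromh loop; apply: (@primitive_hub _ _ (inord h) S T) => //.
  move=> a; have [s sS] := toh a (ltn_ord a).
  by rewrite /reach inord_val; exists s.
move=> a; have [s sS] := fromh a (ltn_ord a).
by rewrite /reach inord_val; exists s.
Qed.

(** The hub is [q - 1], which occurs in its own image and so has return paths of every length.
    One-letter images raise the index by 2: odd letters climb to [q - 1], even ones to [q - 2],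
    whose image contains [q - 1]. The image of the hub contains 0 and 1, from which all letters are
    reached. *)
Lemma primitive_theta_even : ~~ odd q -> primitive_subst (theta q).
Proof.
move=> eq; have eqF := negbTE eq.
have step k j : (k + 2 * j <= q - 1)%N -> reach j k (k + 2 * j)%N.
  elim: j => [|j IH] kj; first by rewrite muln0 addn0 reach0.
  have R1 : reach j k (k + 2 * j)%N by apply: IH; lia.
  apply: reach_transE R1 (reach1 _ _) _; last by lia.
    by rewrite theta_sizeE eqF; lia.
  rewrite /theta_word eqF /theta_even ifT; last by lia.
  by rewrite inE; lia.
have last1 n : n \in [:: 0; q - 1; 1]%N -> reach 1 (q - 1) n.
  move=> nq; apply: reach1; first by rewrite theta_sizeE eqF; lia.
  rewrite /theta_word eqF /theta_even ifF; last by lia.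
  by rewrite ifF//; lia.
apply: (@primitive_hub_nat (q - 1) q 1) => //.
- rewrite theta_sizeE eqF => a aq; case: (boolP (odd a)) => oa.
    exists ((q - 1 - a) %/ 2)%N; first by lia.
    have -> : (q - 1 = a + 2 * ((q - 1 - a) %/ 2))%N by lia.
    rewrite [X in reach X _ _](_ : _ = ((q - 1 - a) %/ 2)%N); last by lia.
    by apply: step; lia.
  exists ((q - 2 - a) %/ 2 + 1)%N; first by lia.
  have := @step a ((q - 2 - a) %/ 2)%N.
  rewrite (_ : (a + _ = q - 2)%N); last by lia.
  move=> H; apply: reach_trans (H _) (reach1 _ _); first by lia.
    by rewrite theta_sizeE eqF; lia.
  rewrite /theta_word eqF /theta_even ifF; last by lia.
  by rewrite eqxx !inE eqxx orbT.
- rewrite theta_sizeE eqF => b bq; case: (boolP (odd b)) => ob.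
    exists (1 + b %/ 2)%N; first by lia.
    apply: (@reach_trans _ _ _ 1%N); first by rewrite last1// !inE eqxx !orbT.
    have -> : b = (1 + 2 * (b %/ 2))%N by lia.
    rewrite [X in reach X _ _](_ : _ = (b %/ 2)%N); last by lia.
    by apply: step; lia.
  exists (1 + b %/ 2)%N; first by lia.
  apply: (@reach_trans _ _ _ 0%N); first by rewrite last1// !inE eqxx.
  have -> : b = (0 + 2 * (b %/ 2))%N by lia.
  rewrite [X in reach X _ _](_ : _ = (b %/ 2)%N); last by lia.
  by apply: step; lia.
- move=> n _; rewrite -[n]muln1; apply: reach_iter.
  by apply: last1; rewrite !inE eqxx orbT.
Qed.

(** One-letter images alternate between the two halves of the alphabet. This gives two chains
    [node i 0], [node i 1], ..., ending at [q - 1] for [i = false] and at [2 * q - 1] for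
    [i = true]. The hub [q - 1] lies on a cycle of length 2 through [2 * q - 1] and on one of length
    [q] along the first chain. As [q] is odd, every length at least [q] is a multiple of 2 or [q]
    plus such a multiple. *)
Lemma primitive_theta_odd : odd q -> primitive_subst (theta q).
Proof.
move=> oq.
pose node (i : bool) k := if i (+) odd k then (q + k)%N else k.
have stepn k n : (k < 2 * q)%N -> n \in theta_odd q k -> reach 1 k n.
  by move=> kq nk; apply: reach1; rewrite ?theta_sizeE /theta_word oq.
have step i k j : (k + j <= q - 1)%N -> reach j (node i k) (node i (k + j)%N).
  elim: j => [|j IH] kj; first by rewrite addn0 reach0.
  have R1 : reach j (node i k) (node i (k + j)%N) by apply: IH; lia.
  apply: reach_transE R1 (stepn _ _ _ _) _; last by lia.
    by rewrite /node; case: ifP; lia.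
  rewrite /node addnS /= addbN; case: (i (+) odd (k + j)) => /=.
    rewrite /theta_odd ifF; last by lia.
    rewrite ifF; last by lia.
    by rewrite ifT; [rewrite inE|]; lia.
  rewrite /theta_odd ifT; last by lia.
  by rewrite inE; lia.
have e0 : node false (q - 1)%N = (q - 1)%N by rewrite /node ifF//; lia.
have e1 : node true (q - 1)%N = (2 * q - 1)%N.
  by rewrite /node ifT; lia.
have last0 n : n \in [:: 0; 2 * q - 1]%N -> reach 1 (q - 1) n.
  move=> nq; apply: stepn; first by lia.
  by rewrite /theta_odd ifF ?eqxx//; lia.
have last1 n : n \in [:: q - 1; q]%N -> reach 1 (2 * q - 1) n.
  move=> nq; apply: stepn; first by lia.
  rewrite /theta_odd ifF; last by lia.
  by rewrite ifF ?ifF//; lia.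
have hub2 : reach 2 (q - 1) (q - 1).
  apply: (@reach_trans 1 1 _ (2 * q - 1)%N); first by rewrite last0// !inE eqxx orbT.
  by rewrite last1// !inE eqxx.
have hubq : reach q (q - 1) (q - 1).
  have := @step false 0%N (q - 1)%N; rewrite add0n e0 => H.
  apply: reach_transE (last0 0%N _) (H _) _; [|by lia..].
  by rewrite !inE eqxx.
have nodeP a : (a < 2 * q)%N -> exists i k, (k < q)%N /\ a = node i k.
  move=> aq; case: (ltnP a q) => qa.
    by exists (odd a), a; rewrite /node addbb.
  exists (~~ odd (a - q)), (a - q)%N; split; first by lia.
  by rewrite /node addNb addbb /=; lia.
apply: (@primitive_hub_nat (q - 1) (q + 1) q) => //; first by lia.
- rewrite theta_sizeE oq => a /nodeP[i [k [kq ->]]].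
  have := @step i k (q - 1 - k)%N.
  rewrite (_ : (k + _ = q - 1)%N); last by lia.
  move=> /(_ (leqnn _)); case: i => [|] H.
    exists (q - 1 - k + 1)%N; first by lia.
    rewrite e1 in H; apply: reach_trans H _.
    by rewrite last1// !inE eqxx.
  by rewrite e0 in H; exists (q - 1 - k)%N; first by lia.
- rewrite theta_sizeE oq => b /nodeP[i [k [kq ->]]].
  have := @step i 0%N k; rewrite add0n => /(_ ltac:(lia)).
  case: i => H.
    exists (2 + k)%N; first by lia.
    apply: reach_trans H; rewrite /node /= addn0.
    apply: (@reach_trans 1 1 _ (2 * q - 1)%N).
      by rewrite last0// !inE eqxx orbT.
    by rewrite last1// !inE eqxx orbT.
  exists (1 + k)%N; first by lia.
  apply: reach_trans H; rewrite /node /=.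
  by rewrite last0// !inE eqxx.
- move=> n qn; case: (boolP (odd n)) => on.
    apply: (reach_transE hubq (reach_iter ((n - q) %/ 2) hub2)).
    by lia.
  by rewrite (_ : n = (n %/ 2 * 2)%N); [exact: reach_iter|lia].
Qed.

(** One-letter images give all basis vectors except those of 0 and [q] (odd case) or of 0 and 1
    (even case). For odd [q] these two remain when a known vector is subtracted from each two-letter
    image. For even [q] the images of [q - 1] and [q - 2] differ by the letter 1, and then 0 comes
    from the image of [q - 2]. *)
Lemma unimodular_theta : unimodular_subst (theta q).
Proof.
apply: unimodular_span => P PB Ptheta.
pose E n : 'cV[int]_(theta_max q).+1 := delta_mx (inord n) 0.
pose N := if odd q then (2 * q)%N else q.
have PT k : (k < N)%N -> P (\sum_(n <- theta_word k) E n).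
  rewrite /N -theta_sizeE => kN.
  by have := Ptheta (inord k); rewrite sum_theta inordK.
suff PE n : (n < N)%N -> P (E n).
  move=> a; rewrite -[a]inord_val; apply: PE.
  by rewrite /N -theta_sizeE.
move: PT; rewrite /N /theta_word; case: ifP => oq PT.
  have up k : (k <= q - 2)%N -> P (E (q + k + 1)%N).
    move=> kq; have := PT k ltac:(lia).
    by rewrite /theta_odd kq big_seq1.
  have down k : (k <= q - 2)%N -> P (E (k + 1)%N).
    move=> kq; have := PT (q + k)%N ltac:(lia).
    rewrite /theta_odd ifF; last by lia.
    rewrite ifF; last by lia.
    rewrite ifT; last by lia.
    by rewrite big_seq1 (_ : (q + k - q = k)%N)//; lia.
  have E0 : P (E 0%N).
    have := PT (q - 1)%N ltac:(lia).
    rewrite /theta_odd ifF; last by lia.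
    rewrite eqxx !big_cons big_nil addr0 => H.
    have := PB _ _ H (up (q - 2)%N ltac:(lia)).
    rewrite (_ : (q + (q - 2) + 1 = 2 * q - 1)%N); last by lia.
    by rewrite addrK.
  have Eq : P (E q).
    have := PT (2 * q - 1)%N ltac:(lia).
    rewrite /theta_odd ifF; last by lia.
    rewrite ifF; last by lia.
    rewrite ifF; last by lia.
    rewrite !big_cons big_nil addr0 => H.
    have := PB _ _ H (down (q - 2)%N ltac:(lia)).
    rewrite (_ : (q - 2 + 1 = q - 1)%N); last by lia.
    by rewrite addrAC subrr add0r.
  move=> nq; have [->//|n0] := eqVneq n 0%N.
  have [->//|nq'] := eqVneq n q.
  case: (ltnP n q) => qn.
    rewrite (_ : n = n - 1 + 1)%N; last by lia.
    by apply: down; lia.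
  rewrite (_ : n = q + (n - q - 1) + 1)%N; last by lia.
  by apply: up; lia.
have up k : (k + 3 <= q)%N -> P (E (k + 2)%N).
  move=> kq; have := PT k ltac:(lia).
  by rewrite /theta_even kq big_seq1.
have := PT (q - 2)%N ltac:(lia); have := PT (q - 1)%N ltac:(lia).
rewrite /theta_even ifF; last by lia.
rewrite ifF; last by lia.
rewrite ifF; last by lia.
rewrite eqxx !big_cons big_nil !addr0 => H1 H2.
have E1 : P (E 1%N).
  by have := PB _ _ H1 H2; rewrite addrA [_ + E 1%N]addrC addrK.
have El : P (E (q - 1)%N).
  have [->//|qn2] := eqVneq q 2%N.
  by rewrite (_ : q - 1 = q - 3 + 2)%N; [apply: up; lia|lia].
have E0 : P (E 0%N) by have := PB _ _ H2 El; rewrite addrK.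
move=> nq; have [->//|n0] := eqVneq n 0%N.
have [->//|n1] := eqVneq n 1%N.
by rewrite (_ : n = n - 2 + 2)%N; [apply: up; lia|lia].
Qed.

End Theta.

(** * Eigenvectors and the dominant root *)

Section Recurrences.
Variables (L : idomainType) (q : nat) (mu : L) (W : nat -> L).
Hypothesis q2 : (2 <= q)%N.
Hypothesis eigW : forall k, (k < (theta_max q).+1)%N ->
  \sum_(n <- theta_word q k) W n = mu * W k.

(** With [e] a sign, the combinations [W k + e * W (q + k)] diagonalize the exchange of the two
    halves of the alphabet. They form a geometric progression of ratio [e * mu], and the two letters
    with longer images close it up into a polynomial equation. *)
Lemma eig_odd (e : L) : odd q -> e ^+ 2 = 1 ->
  (forall k, (k < q)%N ->
     W k + e * W (q + k)%N = (e * mu) ^+ k * (W 0%N + e * W q)) /\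
  ((e * mu) ^+ q - (e * mu) ^+ (q - 1) - e) * (W 0%N + e * W q) = 0.
Proof.
move=> oq e2; move: eigW; rewrite theta_sizeE// /theta_word oq => H.
have D k : (k < q)%N ->
    W k + e * W (q + k)%N = (e * mu) ^+ k * (W 0%N + e * W q).
  elim: k => [|k IH] kq; first by rewrite addn0 expr0 mul1r.
  have := H k ltac:(lia); have := H (q + k)%N ltac:(lia).
  rewrite /theta_odd ifF; last by lia.
  rewrite ifF; last by lia.
  rewrite ifT; last by lia.
  rewrite ifT; last by lia.
  rewrite !big_seq1 (_ : (q + k - q + 1 = k.+1)%N); last by lia.
  rewrite (_ : (q + k + 1 = q + k.+1)%N); last by lia.
  move=> -> ->; rewrite exprS -mulrA -IH; last by lia.
  transitivity (mu * (e * W k + e ^+ 2 * W (q + k)%N)); last by ring.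
  by rewrite e2; ring.
split=> //.
have := H (q - 1)%N ltac:(lia); have := H (2 * q - 1)%N ltac:(lia).
rewrite /theta_odd ifF; last by lia.
rewrite ifF; last by lia.
rewrite ifF; last by lia.
rewrite ifF; last by lia.
rewrite eqxx !big_cons !big_nil !addr0 => H1 H2.
have := D (q - 1)%N ltac:(lia).
rewrite (_ : (q + (q - 1) = 2 * q - 1)%N); last by lia.
have qE : (e * mu) ^+ q = e * mu * (e * mu) ^+ (q - 1).
  by rewrite -exprS; congr (_ ^+ _); lia.
move=> DE; rewrite !mulrBl qE -[_ * _ ^+ _ * _]mulrA -DE.
have -> : e * mu * (W (q - 1)%N + e * W (2 * q - 1)%N)
  = e * (W 0%N + W (2 * q - 1)%N + e * (W (q - 1)%N + W q)).
  by rewrite H1 H2; ring.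
transitivity ((e ^+ 2 - 1) * W (q - 1)%N).
  by ring.
by rewrite e2 subrr mul0r.
Qed.

(** Even and odd indices form two geometric progressions of ratio [mu]. What remains are the
    equations at [q - 2] and [q - 1]; the second is simplified by the first, since the word
    [0 (q - 1)] is a prefix of both images. *)
Lemma eig_even : ~~ odd q ->
  [/\ forall j, (2 * j <= q - 2)%N -> W (2 * j)%N = mu ^+ j * W 0%N,
      forall j, (2 * j <= q - 2)%N -> W (2 * j + 1)%N = mu ^+ j * W 1%N,
      mu ^+ (q./2) * W 0%N = W 0%N + mu ^+ (q./2 - 1) * W 1%N &
      mu ^+ (q./2) * W 1%N = mu ^+ (q./2) * W 0%N + W 1%N].
Proof.
move=> oq; move: eigW; rewrite theta_sizeE// /theta_word (negbTE oq) => H.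
have D k : (k + 3 <= q)%N -> W (k + 2)%N = mu * W k.
  move=> kq; have := H k ltac:(lia).
  by rewrite /theta_even kq big_seq1.
have D0 j : (2 * j <= q - 2)%N -> W (2 * j)%N = mu ^+ j * W 0%N.
  elim: j => [|j IH] jq; first by rewrite expr0 mul1r.
  rewrite (_ : (2 * j.+1 = 2 * j + 2)%N); last by lia.
  by rewrite D ?IH ?exprS ?mulrA//; lia.
have D1 j : (2 * j <= q - 2)%N -> W (2 * j + 1)%N = mu ^+ j * W 1%N.
  elim: j => [|j IH] jq; first by rewrite expr0 mul1r.
  rewrite (_ : (2 * j.+1 + 1 = 2 * j + 1 + 2)%N); last by lia.
  by rewrite D ?IH ?exprS ?mulrA//; lia.
have := H (q - 2)%N ltac:(lia); have := H (q - 1)%N ltac:(lia).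
rewrite /theta_even ifF; last by lia.
rewrite ifF; last by lia.
rewrite ifF; last by lia.
rewrite eqxx !big_cons !big_nil !addr0.
have := D0 (q./2 - 1)%N ltac:(lia); have := D1 (q./2 - 1)%N ltac:(lia).
rewrite (_ : (2 * (q./2 - 1) = q - 2)%N); last by lia.
rewrite (_ : (q - 2 + 1 = q - 1)%N); last by lia.
move=> W1 W0 H1 H2.
have q2E : q./2 = (q./2 - 1).+1 by lia.
have E0 : mu ^+ q./2 * W 0%N = W 0%N + mu ^+ (q./2 - 1) * W 1%N.
  by rewrite {1}q2E exprS -mulrA -W0 -H2 W1.
split=> //.
rewrite {1}q2E exprS -mulrA -W1 -H1 addrA; congr (_ + _).
by rewrite H2 W0 mulrA -exprS -q2E.
Qed.

End Recurrences.

(** Here [t] and [u] are the moduli of [z = a + ib] and of [z - 1]. If [t >= beta], then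
    [t ^+ n >= beta ^+ n] and [u >= t - 1 >= beta - 1], while both products equal 1. So all
    inequalities are equalities, and equality in the triangle inequality puts [z] on the positive
    real axis. *)
Lemma tight_triangle (R : realType) n (beta a b t u : R) :
  1 < beta -> beta ^+ n * (beta - 1) = 1 -> 0 <= t -> 0 <= u ->
  t ^+ 2 = a ^+ 2 + b ^+ 2 -> u ^+ 2 = (a - 1) ^+ 2 + b ^+ 2 ->
  t ^+ n * u = 1 -> beta <= t -> a = beta /\ b = 0.
Proof.
move=> b1 bn t0 u0 t2 u2 tu bt.
have le_at : a <= t.
  rewrite leNgt; apply/negP => ta.
  have : t ^+ 2 < a ^+ 2 by rewrite ltrXn2r.
  have := sqr_ge0 b; lra.
have ut : t - 1 <= u.
  rewrite leNgt; apply/negP => ut.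
  have : u ^+ 2 < (t - 1) ^+ 2 by rewrite ltrXn2r.
  by rewrite u2; lra.
have b0 : 0 < beta by apply: lt_trans b1.
have bp : 0 < beta ^+ n by exact: exprn_gt0.
have bpt : beta ^+ n <= t ^+ n by rewrite lerXn2r// nnegrE ltW.
set B := beta ^+ n in bn bp bpt; set T := t ^+ n in tu bpt.
have tb : t = beta by apply/eqP; rewrite eq_le bt andbT; nra.
have ub : u = t - 1.
  have : B * (u - (beta - 1)) = 0.
    by rewrite mulrBr bn /B -tb tu subrr.
  by move/eqP; rewrite mulf_eq0 gt_eqF//= subr_eq0 tb => /eqP.
have ab : a = t by move: u2 t2; rewrite ub; nra.
split; first by rewrite ab.
have : b ^+ 2 = 0 by move: t2; rewrite ab; lra.
by move/eqP; rewrite sqrf_eq0 => /eqP.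
Qed.

Section EigenvalueModulus.
Local Open Scope complex_scope.
Variables (R : realType) (q : nat) (beta : R).
Hypotheses (b1 : 1 < beta)
  (bq : beta ^+ (q - 1) * (beta - 1) = 1).

(* If [|z| >= beta], the triangle inequality [|z| - 1 <= |z - 1|] must be an
   equality, which puts [z] on the positive real axis. *)
Lemma modulus_lt (z e : R[i]) : `|e| = 1 ->
  z ^+ (q - 1) * (z - 1) = e -> z = beta%:C \/ `|z| < beta%:C.
Proof.
move=> e1 zE; case: z zE => a b zE.
have normE (x y : R) : exists t : R,
    [/\ 0 <= t, t ^+ 2 = x ^+ 2 + y ^+ 2 & `|x +i* y| = t%:C].
  exists (Num.sqrt (x ^+ 2 + y ^+ 2)); split; rewrite ?sqrtr_ge0//.
    by rewrite sqr_sqrtr// addr_ge0// sqr_ge0.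
have [t [t0 t2 zt]] := normE a b; have [u [u0 u2 zu]] := normE (a - 1) b.
have tu : t ^+ (q - 1) * u = 1.
  have := congr1 Num.norm zE; rewrite e1 normrM normrX zt.
  rewrite (_ : a +i* b - 1 = (a - 1) +i* b); last by apply/eqP; rewrite eq_complex /= subr0 !eqxx.
  by rewrite zu -rmorphXn -rmorphM => -[].
rewrite zt ltcR; case: (ltP t beta) => [|bt]; [by right|left].
by have [-> ->] := tight_triangle b1 bq t0 u0 t2 u2 tu bt.
Qed.

End EigenvalueModulus.

(** Stated over a semiring so that it applies both to the real number [beta] and to its image in
    [Kring]. *)
Definition theta_root (L : pzSemiRingType) (q : nat) (beta : L) : L :=
  if odd q then beta else beta ^+ 2.

Section DominantRoot.
Local Open Scope complex_scope.
Variables (R : realType) (q : nat) (beta : R).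
Hypotheses (q2 : (2 <= q)%N) (b1 : 1 < beta)
  (bq : beta ^+ q = beta ^+ (q - 1) + 1).

Local Notation lam := (theta_root q beta).

Definition letter_exp k := if (k < q)%N then k else (k - q)%N.

(** One-letter images raise the exponent by 1 (odd [q]) or 2 (even [q]); for the longer images the
    relation [bq] sums up the powers. *)
Lemma letter_exp_eig k : (k < (theta_max q).+1)%N ->
  \sum_(n <- theta_word q k) beta ^+ letter_exp n
    = lam * beta ^+ letter_exp k.
Proof.
have bS n : beta ^+ n.+1 = beta * beta ^+ n by rewrite exprS.
have qE : q = (q - 1).+1 by lia.
have bqS : beta * beta ^+ (q - 1) = beta ^+ (q - 1) + 1.
  by rewrite -bS -qE.
have q1E : (q - 1 = (q - 2).+1)%N by lia.
rewrite theta_sizeE// /theta_root /theta_word; case: ifP => oq kN.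
  rewrite /theta_odd; case: ifP => [k2|/negbT k2].
    rewrite big_seq1 /letter_exp ifF; last by lia.
    rewrite ifT; last by lia.
    by rewrite -bS; congr (_ ^+ _); lia.
  case: ifP => [/eqP ->|/negbT kq].
    rewrite !big_cons big_nil addr0 /letter_exp ifT; last by lia.
    rewrite ifF; last by lia.
    rewrite ifT; last by lia.
    by rewrite expr0 bqS addrC (_ : 2 * q - 1 - q = q - 1)%N//; lia.
  case: ifP => [k3|/negbT k3].
    rewrite big_seq1 /letter_exp ifT; last by lia.
    rewrite ifF; last by lia.
    by rewrite -bS; congr (_ ^+ _); lia.
  rewrite !big_cons big_nil addr0 /letter_exp ifT; last by lia.
  rewrite ifF; last by lia.
  rewrite ifF; last by lia.
  by rewrite subnn expr0 -bqS; congr (_ * _ ^+ _); lia.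
rewrite /theta_even expr2; case: ifP => [k3|/negbT k3].
  rewrite big_seq1 /letter_exp ifT; last by lia.
  rewrite ifT; last by lia.
  by rewrite -mulrA -!bS addn2.
case: ifP => [/eqP ->|/negbT kq].
  rewrite !big_cons big_nil addr0 /letter_exp ifT; last by lia.
  rewrite ifT; last by lia.
  rewrite ifT; last by lia.
  by rewrite -mulrA -bS -q1E expr0 bqS addrC.
rewrite !big_cons big_nil addr0 /letter_exp ifT; last by lia.
rewrite ifT; last by lia.
rewrite ifT; last by lia.
rewrite ifT; last by lia.
rewrite (_ : k = q - 1)%N; last by lia.
by rewrite -mulrA bqS expr0 expr1 mulrDr bqS; ring.
Qed.

Lemma beta_pow : beta ^+ (q - 1) * (beta - 1) = 1.
Proof.
rewrite mulrBr mulr1 -exprSr (_ : (q - 1).+1 = q); last by lia.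
by rewrite bq addrAC subrr add0r.
Qed.

Lemma theta_eig_word (L : pzRingType) (mu : L) (w : 'rV[L]_(theta_max q).+1) :
  w *m map_mx intr (incidence_mx (theta q)) = mu *: w <->
  forall k, (k < (theta_max q).+1)%N ->
    \sum_(n <- theta_word q k) w 0 (inord n) = mu * w 0 (inord k).
Proof.
split=> [wE k kN|wE].
  have := congr1 (fun A : 'rV_ _ => A 0 (inord k)) wE.
  by rewrite mulmx_incidence sum_theta inordK// mxE.
apply/rowP => k; rewrite mulmx_incidence sum_theta mxE wE ?ltn_ord//.
by rewrite inord_val.
Qed.

Lemma theta_root_gt0 : 0 < lam.
Proof. by rewrite /theta_root; case: ifP => _; rewrite ?exprn_gt0// (lt_trans ltr01 b1). Qed.

Lemma row_eq0_inord (L : nmodType) n (w : 'rV[L]_n.+1) :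
  (forall k, (k < n.+1)%N -> w 0 (inord k) = 0) -> w = 0.
Proof. by move=> H; apply/rowP => k; rewrite mxE -[k]inord_val H. Qed.

Lemma theta_eigenvalue_lt (mu : R[i]) :
  eigenvalue (map_mx intr (incidence_mx (theta q))) mu ->
  mu != lam%:C -> `|mu| < lam%:C.
Proof.
case/eigenvalueP => w /theta_eig_word eigw w0.
pose W n := w 0 (inord n).
have {eigw} eigW k : (k < (theta_max q).+1)%N ->
  \sum_(n <- theta_word q k) W n = mu * W k := eigw k.
rewrite /theta_root; case: ifP => [oq|/negbT oq] mul.
  (* If the sum vanished for both signs [e = 1] and [e = -1], [eig_odd] would make every
     [W k + W (q + k)] and [W k - W (q + k)] zero, hence [w = 0]. *)
  have [e [e2 De]] : exists e : R[i], e ^+ 2 = 1 /\ W 0%N + e * W q != 0.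
    apply: contrapT => /forallNP H.
    have D (e : R[i]) : e ^+ 2 = 1 -> W 0%N + e * W q = 0.
      by move=> e2; apply: contrapT => He; apply: (H e); split=> //; apply/eqP.
    have De (e : R[i]) k : e ^+ 2 = 1 -> (k < q)%N -> W k + e * W (q + k)%N = 0.
      move=> e2 kq; have [-> // _] := eig_odd q2 eigW oq e2.
      by rewrite (D e e2) mulr0.
    move/eqP: w0; apply; apply: row_eq0_inord => k kN.
    rewrite -/(W k); move: kN; rewrite theta_sizeE// oq => kN.
    have [k' [k'q]] : exists k', (k' < q)%N /\ (k = k' \/ k = q + k')%N.
      case: (ltnP k q) => kq; first by exists k; split=> //; left.
      by exists (k - q)%N; split; [lia|right; lia].
    have H1 := De 1 k' (expr1n _ _) k'q.
    have H2 := De (-1) k' ltac:(by rewrite sqrrN expr1n) k'q.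
    rewrite mul1r in H1; rewrite mulN1r in H2.
    have Wk0 : W k' = 0.
      have : 2 * W k' = 0.
        transitivity ((W k' + W (q + k')%N) + (W k' - W (q + k')%N)); first by ring.
        by rewrite H1 H2 addr0.
      by move/eqP; rewrite mulf_eq0 pnatr_eq0 => /eqP.
    by move: H1; rewrite Wk0 add0r => ? [] ->.
  have [_ /eqP] := eig_odd q2 eigW oq e2.
  rewrite mulf_eq0 (negbTE De) orbF subr_eq0 => /eqP zE.
  have e1 : `|e| = 1.
    have : `|e| ^+ 2 = 1 by rewrite -normrX e2 normr1.
    by move/eqP; rewrite sqrf_eq1 => /orP[/eqP //|/eqP h]; have := normr_ge0 e; rewrite h ler0N1.
  have em : `|e * mu| = `|mu| by rewrite normrM e1 mul1r.
  have zE' : (e * mu) ^+ (q - 1) * (e * mu - 1) = e.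
    rewrite mulrBr mulr1 -exprSr (_ : (q - 1).+1 = q)//; lia.
  have [zb|] := modulus_lt b1 beta_pow e1 zE'; last by rewrite em.
  (* For [e * mu = beta] the equation itself yields [e = 1], so [mu = beta], which is excluded. *)
  move: zE'; rewrite zb -[1]/(1%:C) -rmorphXn -rmorphB -rmorphM beta_pow => e1'.
  by move: zb mul; rewrite -e1' mul1r => ->; rewrite eqxx.
have [_ Wodd E0 E1] := eig_even q2 eigW oq.
have [z zE] : exists z : R[i], z ^+ 2 = mu by exists (sqrtc mu); rewrite sqr_sqrtc.
(* The value 0 is set aside because deducing [W 1 = 0] from [W 0 = 0] cancels a power of [mu]. *)
have [mu0|mu0] := eqVneq mu 0.
  by rewrite mu0 normr0 ltcR exprn_gt0// (lt_trans ltr01 b1).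
have W0 : W 0%N != 0.
  apply: contra_neq w0 => W0.
  have W1 : W 1%N = 0.
    move/eqP: E0; rewrite W0 mulr0 add0r eq_sym mulf_eq0 expf_eq0 (negbTE mu0).
    by rewrite andbF => /eqP.
  have [Wev _ _ _] := eig_even q2 eigW oq.
  apply: row_eq0_inord => k kN.
  rewrite -/(W k); move: kN; rewrite theta_sizeE// (negbTE oq) => kq.
  case: (boolP (odd k)) => ok.
    by rewrite (_ : k = 2 * (k %/ 2) + 1)%N ?Wodd ?W1 ?mulr0//; lia.
  by rewrite (_ : k = 2 * (k %/ 2))%N ?Wev ?W0 ?mulr0//; lia.
have zq : mu ^+ q./2 = z ^+ q by rewrite -zE -exprM; congr (_ ^+ _); lia.
have zq1 : mu ^+ (q./2 - 1) * z ^+ q = z ^+ (q - 1) * z ^+ (q - 1).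
  by rewrite -zE -exprM -!exprD; congr (_ ^+ _); lia.
(* Elimination of [W 1] from the last two equations of [eig_even], followed by cancelling [W 0]. *)
have : (z ^+ q - 1) ^+ 2 == (z ^+ (q - 1)) ^+ 2.
  rewrite -subr_eq0 -(mulIr_eq0 _ (mulIf W0)) mulrBl.
  have -> : (z ^+ q - 1) ^+ 2 * W 0%N = mu ^+ (q./2 - 1) * z ^+ q * W 0%N.
    rewrite -zq [in RHS]mulrAC -mulrA.
    transitivity ((mu ^+ q./2 - 1) * (mu ^+ q./2 * W 0%N - W 0%N)); first by ring.
    have -> : mu ^+ q./2 * W 0%N - W 0%N = mu ^+ (q./2 - 1) * W 1%N by rewrite E0; ring.
    have -> : mu ^+ (q./2 - 1) * (W 0%N * mu ^+ q./2) =
      mu ^+ (q./2 - 1) * (mu ^+ q./2 * W 1%N - W 1%N) by rewrite E1; ring.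
    by ring.
  by rewrite zq1 -expr2 subrr.
rewrite eqf_sqr => Hz.
(* The square root of [mu] is chosen with the right sign: as [q] is even, passing from [z] to [- z]
   changes the sign of [z ^+ (q - 1)] only. *)
have [y [yE yz]] : exists y : R[i],
    y ^+ 2 = mu /\ y ^+ q = y ^+ (q - 1) + 1.
  case/orP: Hz => /eqP Hz.
    by exists z; split=> //; rewrite -Hz subrK.
  exists (- z); split; first by rewrite sqrrN.
  have sq : (-1 : R[i]) ^+ q = 1 by rewrite -signr_odd (negbTE oq).
  have sq1 : (-1 : R[i]) ^+ (q - 1) = -1.
    by rewrite -signr_odd (_ : odd (q - 1))//; lia.
  rewrite [(- z) ^+ q]exprNn [(- z) ^+ _]exprNn sq sq1.
  by rewrite mul1r mulN1r -Hz subrK.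
have yE' : y ^+ (q - 1) * (y - 1) = 1.
  rewrite mulrBr mulr1 -exprSr (_ : (q - 1).+1 = q); last by lia.
  by rewrite yz addrAC subrr add0r.
have [yb|yb] := modulus_lt b1 beta_pow (normr1 _) yE'.
  by move: mul; rewrite -yE yb -rmorphXn eqxx.
rewrite -yE normrX rmorphXn ltrXn2r//.
Qed.

Lemma dominant_root_theta : dominant_root (theta q) lam.
Proof.
split; [exact: theta_root_gt0| |exact: theta_eigenvalue_lt].
apply/eigenvalueP; exists (\row_k beta ^+ letter_exp k).
  apply/theta_eig_word => k kN; rewrite mxE inordK// -letter_exp_eig//.
  rewrite big_seq [RHS]big_seq; apply: eq_bigr => n nk.
  by rewrite mxE inordK//; apply: theta_word_lt nk.
apply/eqP => /rowP/(_ ord0); rewrite !mxE => /eqP.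
by rewrite expf_eq0 gt_eqF ?andbF// (lt_trans ltr01 b1).
Qed.

(** The eigenspace is a line: the recurrences express every entry through [W 0] once [W q = W 0]
    (odd [q]) or [W 1 = beta * W 0] (even [q]) is known. *)
Lemma left_PF_theta (nu : 'rV[R]_(theta_max q).+1) :
  nu *m map_mx intr (incidence_mx (theta q)) = lam *: nu ->
  forall k, nu 0 k = beta ^+ letter_exp k * nu 0 ord0.
Proof.
move/theta_eig_word => eignu k; pose W n := nu 0 (inord n).
have {eignu} eigW l : (l < (theta_max q).+1)%N ->
  \sum_(n <- theta_word q l) W n = lam * W l := eignu l.
have -> : nu 0 ord0 = W 0%N.
  by rewrite /W; congr (nu 0 _); apply/val_inj; rewrite /= inordK.
rewrite -[k in LHS]inord_val -/(W k).
have := ltn_ord k; rewrite [X in (_ < X)%N]theta_sizeE//.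
have b0 : 0 < beta by apply: lt_trans b1.
have bp n : 0 < beta ^+ n by exact: exprn_gt0.
have qE : beta ^+ q = beta * beta ^+ (q - 1).
  by rewrite -exprS; congr (_ ^+ _); lia.
move: eigW; rewrite /theta_root; case: ifP => [oq|/negbT oq] eigW kN.
  have [D1 _] := eig_odd q2 eigW oq (expr1n _ 2).
  have [|D2 E2] := @eig_odd _ _ _ _ q2 eigW (-1) oq.
    by rewrite sqrrN expr1n.
  (* For [e = -1] the polynomial factor in [eig_odd] equals [- 2 * beta ^+ (q - 1)], which is
     nonzero. *)
  have D0 : W 0%N = W q.
    move: E2 => /eqP; rewrite mulf_eq0 !mulN1r => /orP[|]; last first.
      by rewrite subr_eq0 => /eqP.
    rewrite subr_eq0.
    have sq : (-1 : R) ^+ q = -1 by rewrite -signr_odd oq.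
    have sq1 : (-1 : R) ^+ (q - 1) = 1.
      by rewrite -signr_odd (_ : odd (q - 1) = false)//; lia.
    rewrite [(- beta) ^+ q]exprNn [(- beta) ^+ _]exprNn sq sq1.
    rewrite mul1r mulN1r qE => /eqP H.
    have := bp (q - 1)%N; have := beta_pow; move: H.
    by set B := beta ^+ (q - 1); nra.
  have E k' : (k' < q)%N ->
      W k' = beta ^+ k' * W 0%N /\ W (q + k')%N = beta ^+ k' * W 0%N.
    move=> kq; have := D1 k' kq; have := D2 k' kq.
    rewrite -D0 !mulN1r !mul1r subrr mulr0 => /eqP; rewrite subr_eq0 => /eqP <-.
    by split; lra.
  rewrite /letter_exp; case: ifP => kq; first by have [] := E k kq.
  have [_] := E (k - q)%N ltac:(lia).
  by rewrite (_ : (q + (k - q) = k)%N)//; lia.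
have [Wev Wod E0 _] := eig_even q2 eigW oq.
have zq : (beta ^+ 2) ^+ q./2 = beta * beta ^+ (q - 1).
  by rewrite -qE -exprM; congr (_ ^+ _); lia.
have zq1 : (beta ^+ 2) ^+ (q./2 - 1) * beta = beta ^+ (q - 1).
  by rewrite -exprM -exprSr; congr (_ ^+ _); lia.
have W1 : W 1%N = beta * W 0%N.
  move: E0; rewrite zq; have := beta_pow; have := bp (q - 1)%N; rewrite -zq1.
  set B := (beta ^+ 2) ^+ _ => Bp H1 H2.
  have Bb : B * beta != 0 by rewrite gt_eqF.
  have Bn0 : B != 0 by apply: contraNneq Bb => ->; rewrite mul0r.
  apply: (mulfI Bn0); transitivity (beta * (B * beta) * W 0%N - W 0%N).
    by rewrite H2; ring.
  by rewrite -[X in _ - X]mul1r -H1; ring.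
rewrite /letter_exp kN; case: (boolP (odd k)) => ok.
  rewrite {1}(_ : nat_of_ord k = 2 * (k %/ 2) + 1)%N; last by lia.
  rewrite Wod ?W1; last by lia.
  by rewrite -exprM mulrA -exprSr; congr (_ ^+ _ * _); lia.
rewrite {1}(_ : nat_of_ord k = 2 * (k %/ 2))%N; last by lia.
rewrite Wev; last by lia.
by rewrite -exprM; congr (_ ^+ _ * _); lia.
Qed.

End DominantRoot.

(** * Uniqueness of Rauzy fractals *)

Section KspaceTopology.
Local Open Scope complex_scope.
Variable R : realType.

(** A sup-norm bound with a radius in [R], written by coordinates because moduli of complex
    coordinates are elements of [R[i]]. *)
Definition Kle r s (e : R) (x : Kspace R r s) : Prop :=
  (forall i, `|x.1 0 i| <= e) /\ (forall j, `|x.2 0 j| <= e%:C).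

Section OneSpace.
Variables r s : nat.
Implicit Types x y z : Kspace R r s.

Lemma Kle_le e e' x : e <= e' -> Kle e x -> Kle e' x.
Proof.
move=> ee' [x1 x2]; split=> k; first exact: le_trans ee'.
by apply: le_trans (x2 k) _; rewrite lecR.
Qed.

Lemma KleD e e' x y : Kle e x -> Kle e' y -> Kle (e + e') (x + y).
Proof.
move=> [x1 x2] [y1 y2]; split=> k; rewrite !mxE.
  by apply: le_trans (ler_normD _ _) _; exact: lerD.
by rewrite rmorphD; apply: le_trans (ler_normD _ _) _; exact: lerD.
Qed.

Lemma KleN e x : Kle e x -> Kle e (- x).
Proof. by move=> [x1 x2]; split=> k; rewrite mxE normrN. Qed.

Lemma KleC e x y : Kle e (x - y) -> Kle e (y - x).
Proof. by move=> /KleN; rewrite opprB. Qed.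

Lemma KleM e e' x y : 0 <= e -> Kle e x -> Kle e' y -> Kle (e * e') (Kmul x y).
Proof.
move=> e0 [x1 x2] [y1 y2]; split=> k; rewrite mxE normrM.
  by apply: ler_pM.
by rewrite rmorphM; apply: ler_pM.
Qed.

Lemma Kle_exists x : exists2 e, 0 <= e & Kle e x.
Proof.
exists (\sum_i `|x.1 0 i| + \sum_j complex.Re `|x.2 0 j|).
  apply: addr_ge0; apply: sumr_ge0 => // j _.
  by have := normr_ge0 (x.2 0 j); rewrite lecE => /andP[].
have s1 : 0 <= \sum_i `|x.1 0 i| by apply: sumr_ge0.
have s2 : 0 <= \sum_j complex.Re `|x.2 0 j|.
  apply: sumr_ge0 => j _.
  by have := normr_ge0 (x.2 0 j); rewrite lecE => /andP[].
split=> k.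
  rewrite (bigD1 k)//= -addrA lerDl addr_ge0// sumr_ge0//.
rewrite -(RRe_real (normr_real (x.2 0 k))) lecR (bigD1 k)//= addrCA lerDl.
rewrite addr_ge0// sumr_ge0// => j _.
by have := normr_ge0 (x.2 0 j); rewrite lecE => /andP[].
Qed.

Lemma KleB_eq x y : (forall e, 0 < e -> Kle e (x - y)) -> x = y.
Proof.
move=> H; apply/eqP; rewrite -subr_eq0; apply/eqP.
have [] : (x - y).1 = 0 /\ (x - y).2 = 0; last first.
  by case: (x - y) => ? ? /= -> ->.
split; apply/rowP => k; rewrite [RHS]mxE; apply/eqP; rewrite -normr_eq0.
  rewrite eq_le normr_ge0 andbT; apply/ler_addgt0Pl => e e0; rewrite addr0.
  by have [] := H e e0.
rewrite -(RRe_real (normr_real _)).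
suff -> : complex.Re `|(x - y).2 0 k| = 0 by [].
apply/eqP; rewrite eq_le.
apply/andP; split; last by have := normr_ge0 ((x - y).2 0 k); rewrite lecE => /andP[].
apply/ler_addgt0Pl => e e0; rewrite addr0; have [_ /(_ k)] := H e e0.
by rewrite lecE => /andP[].
Qed.

(** Boxes form a neighbourhood base of the product topology; the topological arguments below go
    through them. *)
Lemma nbhs_Kle x (U : set (Kspace R r s)) :
  nbhs x U <-> exists2 e, 0 < e & forall y, Kle e (x - y) -> U y.
Proof.
split.
  case=> -[Q1 Q2] /= [/nbhs_ballP[e1 /= e10 B1] /nbhs_ballP[e2 /= e20 B2]] QU.
  (* A positive element of [R[i]] is real, so the radius of the complex ball can be compared with
     [e1]. *)
  have e2R : (complex.Re e2)%:C = e2 by rewrite RRe_real// gtr0_real.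
  have e20' : 0 < complex.Re e2 by rewrite -ltcR e2R.
  have [e [e0 ee1 ee2]] : exists e : R, [/\ 0 < e, e < e1 & e < complex.Re e2].
    exists (Num.min e1 (complex.Re e2) / 2); set m := Num.min _ _.
    have m0 : 0 < m by rewrite lt_min e10.
    have m2 : m / 2 < m by rewrite ltr_pdivrMr// ltr_pMr// ltr1n.
    by split; [rewrite divr_gt0| |]; rewrite ?(lt_le_trans m2)// ge_min lexx ?orbT.
  exists e => // y [y1 y2]; apply: QU; split=> /=.
    apply: B1; split=> // i j; rewrite ord1 -ball_normE /=.
    by have := y1 j; rewrite !mxE => h; apply: le_lt_trans h _.
  apply: B2; split=> // i j; rewrite ord1 -ball_normE /=.
  have := y2 j; rewrite !mxE => h; apply: le_lt_trans h _.
  by rewrite -e2R ltcR.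
move=> [e e0 eU].
exists (ball x.1 e, ball x.2 e%:C) => /=.
  by split; apply: nbhsx_ballx; rewrite // ltcR.
move=> [y1 y2] [/= [_ b1] [_ b2]]; apply: eU; split=> k /=; rewrite !mxE.
  by have := b1 0 k; rewrite -ball_normE /= => /ltW.
by have := b2 0 k; rewrite -ball_normE /= => /ltW.
Qed.

Lemma Kspace_hausdorff : hausdorff_space (Kspace R r s).
Proof.
move=> x y xy; apply: KleB_eq => e e0.
have e20 : 0 < e / 2 by rewrite divr_gt0.
have [| |z [xz yz]] := xy [set z | Kle (e / 2) (x - z)] [set z | Kle (e / 2) (y - z)].
- by apply/nbhs_Kle; exists (e / 2).
- by apply/nbhs_Kle; exists (e / 2).
rewrite [e]splitr -(subrK z x) -addrA; apply: KleD => //; exact: KleC.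
Qed.

Lemma compact_Kle_closed (A : set (Kspace R r s)) x : compact A ->
  (forall e, 0 < e -> exists2 y, A y & Kle e (x - y)) -> A x.
Proof.
move=> /(compact_closed Kspace_hausdorff) clA H; apply: clA => B /nbhs_Kle[e e0 eB].
by have [y Ay xy] := H e e0; exists y; split=> //; exact: eB.
Qed.

(** Around each point every large enough [M] is a bound; compactness, in its near-covering form,
    makes one [M] work on all of [A]. *)
Lemma compact_Kle_bounded (A : set (Kspace R r s)) : compact A ->
  exists2 M, 0 <= M & forall x, A x -> Kle M x.
Proof.
move=> /compact_near_coveringP/(_ R (+oo%R) (fun M x => Kle M x) _) H.
have /H : forall x, A x -> \forall x' \near x & M \near +oo%R, Kle M x'.
  move=> x _; have [e e0 ex] := Kle_exists x.
  exists ([set x' | Kle 1 (x - x')], [set M | e + 1 < M]) => /=.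
    split; first by apply/nbhs_Kle; exists 1.
    by exists (e + 1); split=> //; rewrite num_real.
  move=> [x' M] /= [xx' eM]; apply: Kle_le (ltW eM) _.
  by rewrite -[x'](subrK x) addrC; apply: KleD => //; exact: KleC.
move=> [M [_ MA]]; exists (Num.max 0 (M + 1)); first by rewrite le_max lexx.
by apply: MA; rewrite lt_max ltrDl ltr01 orbT.
Qed.

End OneSpace.

Lemma Lipschitz_continuous r s r' s' (C : R)
    (f : Kspace R r s -> Kspace R r' s') : 0 <= C ->
  (forall e x y, 0 <= e -> Kle e (x - y) -> Kle (C * e) (f x - f y)) ->
  continuous f.
Proof.
move=> C0 fL x U /nbhs_Kle[e e0 eU]; apply/nbhs_Kle.
(* The denominator is [C + 1] because [C] may be 0. *)
have eC : 0 < e / (C + 1) by rewrite divr_gt0// ltr_wpDl.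
exists (e / (C + 1)) => // y xy; apply: eU; apply: Kle_le (fL _ _ _ (ltW eC) xy).
rewrite mulrA ler_pdivrMr ?ltr_wpDl// mulrC ler_wpM2l//; first exact: ltW.
by rewrite lerDl.
Qed.

End KspaceTopology.

Section RauzyUniqueness.
Local Open Scope complex_scope.
Variables (R : realType) (m r s : nat) (zeta : letter_map m) (lam : R).
Variables (c : Kspace R r s) (nu : 'rV[R]_m.+1).
Hypotheses (c1 : forall i, `|c.1 0 i| < 1) (c2 : forall j, `|c.2 0 j| < 1).

Lemma contraction_ratio : exists2 rho, 0 <= rho < 1 & Kle rho c.
Proof.
(* The base value 0 of the maxima covers the cases [r = 0] and [s = 0]. *)
exists (Num.max (\big[Num.max/0]_i `|c.1 0 i|)
                (\big[Num.max/0]_j complex.Re `|c.2 0 j|)).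
  rewrite le_max bigmax_ge_id /= gt_max; apply/andP; split.
    by apply: bigmax_lt => // i _; exact: c1.
  by apply: bigmax_lt => // j _; have := c2 j; rewrite ltcE => /andP[].
split=> k; first by rewrite le_max le_bigmax.
rewrite -(RRe_real (normr_real _)) lecR le_max.
by rewrite (le_bigmax _ (fun j => complex.Re `|c.2 0 j|)) orbT.
Qed.

Lemma KmulBr (x y z : Kspace R r s) : Kmul x (y - z) = Kmul x y - Kmul x z.
Proof.
by congr (_, _); apply/rowP => k; rewrite !mxE mulrBr.
Qed.

(** Unfolding the equation of [X] at a point [n] times and following the same words in [Y] gives a
    point of [Y] at distance at most [rho ^+ n * M]. Since [Y a] is closed, it contains the
    point. *)
Lemma rauzy_fractal_sub (X Y : 'I_m.+1 -> set (Kspace R r s)) :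
  rauzy_fractal zeta lam c nu X -> rauzy_fractal zeta lam c nu Y ->
  forall a, X a `<=` Y a.
Proof.
move=> XE YE a x Xx; have [_ cY _] := YE a.
have [rho /andP[rho0 rho1] rhoc] := contraction_ratio.
have [M M0 MXY] : exists2 M, 0 <= M &
    forall b x y, X b x -> Y b y -> Kle M (x - y).
  have /choice[f fP] : forall b, exists M, 0 <= M /\
      forall x y, X b x -> Y b y -> Kle M (x - y).
    move=> b; have [_ cXb _] := XE b; have [_ cYb _] := YE b.
    have [M1 M10 H1] := compact_Kle_bounded cXb.
    have [M2 M20 H2] := compact_Kle_bounded cYb.
    exists (M1 + M2); split; first exact: addr_ge0.
    by move=> x' y' Xx' Yy'; apply: KleD; [exact: H1|apply/KleN/H2].
  exists (\sum_b f b); first by apply: sumr_ge0 => b _; have [] := fP b.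
  move=> b x' y' Xx' Yy'; have [_ /(_ _ _ Xx' Yy')] := fP b; apply: Kle_le.
  by rewrite (bigD1 b)//= lerDl sumr_ge0// => d _; have [] := fP d.
have approx n : forall b x, X b x -> exists2 y, Y b y & Kle (rho ^+ n * M) (x - y).
  elim: n => [|n IH] b x' Xx'.
    have [[y Yy] _ _] := YE b; exists y => //.
    by rewrite expr0 mul1r; exact: MXY Yy.
  have [_ _ XbE] := XE b; have [_ _ YbE] := YE b.
  move: Xx'; rewrite XbE => -[t /= tb [x0 Xx0 <-]].
  have [y0 Yy0 xy0] := IH _ _ Xx0.
  exists (rauzy_map lam c nu t.1.2 y0).
    by rewrite YbE; exists t => //; exists y0.
  rewrite /rauzy_map opprD addrACA subrr add0r -KmulBr exprS -mulrA.
  exact: KleM.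
apply: compact_Kle_closed cY _ => e e0.
have [n ne] : exists n, rho ^+ n * M <= e.
  have rhoM : geometric M rho n @[n --> \oo] --> 0.
    by apply: cvg_geometric; rewrite ger0_norm.
  move/cvgrPdist_le : rhoM => /(_ e e0)[n _ /(_ n (leqnn n))] /=.
  rewrite sub0r normrN => h; exists n; apply: le_trans h.
  by rewrite mulrC ler_norm.
have [y Yy xy] := approx n a x Xx; exists y => //; exact: Kle_le xy.
Qed.

Lemma rauzy_fractal_unique (X Y : 'I_m.+1 -> set (Kspace R r s)) :
  rauzy_fractal zeta lam c nu X -> rauzy_fractal zeta lam c nu Y ->
  forall a, X a = Y a.
Proof.
by move=> XE YE a; apply/seteqP; split; apply: rauzy_fractal_sub.
Qed.

End RauzyUniqueness.

(** * Transfer between conjugate systems *)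

Section ConjugateCoordinates.
Local Open Scope complex_scope.
Variable R : realType.

(** [embedding] evaluates an arbitrarily chosen polynomial; at a conjugate of [x], all polynomials
    representing [z] take the same value. *)
Lemma embeddingE (x z : R) (y : R[i]) f : galois_conjugates x y ->
  z = evalq x f -> embedding x y z = evalq y f.
Proof.
move=> xy zf; have h : exists p, [set p | z = (ratpoly R p).[x]] p by exists f.
by apply: (conj_evalq_eq xy); rewrite -zf; have /= := xgetPex 0 h.
Qed.

Lemma embeddingE_real (x z y : R) f : galois_conjugates x y%:C ->
  z = evalq x f -> embedding x y z = evalq y f.
Proof.
move=> xy zf; have h : exists p, [set p | z = (ratpoly R p).[x]] p by exists f.
apply: complexI; rewrite -!evalq_real.
by apply: (conj_evalq_eq xy); rewrite -zf; have /= := xgetPex 0 h.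
Qed.

Definition proper_conj (x : R) (y : R[i]) := galois_conjugates x y /\ y != x%:C.

(* [kev c y v] is the coordinate of [v] at the conjugate [y], where [v] is
   completed to a family indexed by all conjugates by asking that complex
   conjugate indices carry complex conjugate values. *)
Definition kev r s (c : Kspace R r s) (y : R[i]) (v : Kspace R r s) : R[i] :=
  if [pick i | (c.1 0 i)%:C == y] is Some i then (v.1 0 i)%:C
  else if [pick j | c.2 0 j == y] is Some j then v.2 0 j
  else if [pick j | (c.2 0 j)^* == y] is Some j then (v.2 0 j)^* else 0.

Section OneSystem.
Variables (r s : nat) (c : Kspace R r s).
Implicit Types (v w : Kspace R r s) (y : R[i]).

Lemma kevD y v w : kev c y (v + w) = kev c y v + kev c y w.
Proof.
rewrite /kev; case: pickP => [i _|_]; first by rewrite mxE rmorphD.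
case: pickP => [j _|_]; first by rewrite mxE.
by case: pickP => [j _|_]; rewrite ?addr0// mxE rmorphD.
Qed.

Lemma kevZ y a v : kev c y (a *: v) = a%:C * kev c y v.
Proof.
rewrite /kev; case: pickP => [i _|_]; first by rewrite mxE rmorphM.
case: pickP => [j _|_]; first by rewrite mxE.
by case: pickP => [j _|_]; rewrite ?mulr0// mxE rmorphM -[X in X * _]/(a%:C^*) conjc_real.
Qed.

Lemma kevM y v w : kev c y (Kmul v w) = kev c y v * kev c y w.
Proof.
rewrite /kev; case: pickP => [i _|_]; first by rewrite mxE rmorphM.
case: pickP => [j _|_]; first by rewrite mxE.
by case: pickP => [j _|_]; rewrite ?mulr0// mxE rmorphM.
Qed.

Lemma kev_le e y v : 0 <= e -> Kle e v -> `|kev c y v| <= e%:C.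
Proof.
move=> e0 [v1 v2]; rewrite /kev; case: pickP => [i _|_].
  by rewrite normc_def /= expr0n addr0 sqrtr_sqr lecR.
case: pickP => [j _|_]; first exact: v2.
by case: pickP => [j _|_]; rewrite ?normcJ// normr0 lecR.
Qed.

Variable x : R.
Hypothesis cs : conjugate_system x c.

Lemma proper_real i : proper_conj x (c.1 0 i)%:C.
Proof.
have [_ /(_ (c.1 0 i)%:C) [H _] _] := cs; apply: H.
rewrite mem_cat; apply/orP; left.
by apply/mapP; exists i; rewrite ?mem_enum.
Qed.

Lemma proper_cplx j : proper_conj x (c.2 0 j).
Proof.
have [_ /(_ (c.2 0 j)) [H _] _] := cs; apply: H.
rewrite !mem_cat; apply/orP; right; apply/orP; left.
by apply/mapP; exists j; rewrite ?mem_enum.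
Qed.

Lemma proper_conjP y : proper_conj x y ->
  [\/ exists i, y = (c.1 0 i)%:C, exists j, y = c.2 0 j |
      exists j, y = (c.2 0 j)^*].
Proof.
have [_ /(_ y) [_ H] _] := cs => /H.
rewrite !mem_cat => /or3P[] /mapP[k _ ->]; [constructor 1|constructor 2|constructor 3];
  by exists k.
Qed.

Lemma kev_real i v : kev c (c.1 0 i)%:C v = (v.1 0 i)%:C.
Proof.
have [+ _ _] := cs; rewrite cat_uniq => /and3P[/injectiveP inj _ _].
rewrite /kev; case: pickP => [k /eqP/inj -> //|/(_ i)].
by rewrite eqxx.
Qed.

Lemma kev_cplx j v : kev c (c.2 0 j) v = v.2 0 j.
Proof.
have [+ _ Im0] := cs; rewrite !cat_uniq => /and3P[_ _ /and3P[/injectiveP inj _ _]].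
rewrite /kev; case: pickP => [k /eqP kj|_].
  by have := Im0 j; rewrite -kj eqxx.
case: pickP => [k /eqP/inj -> //|/(_ j)].
by rewrite eqxx.
Qed.

(** The first two branches of [kev] are excluded because the index is not real and because the list
    of conjugates has no repetition. *)
Lemma kev_cplxJ j v : kev c (c.2 0 j)^* v = (v.2 0 j)^*.
Proof.
have [+ _ Im0] := cs; rewrite !cat_uniq.
move=> /and3P[_ _ /and3P[_ /hasPn disj /injectiveP inj]].
rewrite /kev; case: pickP => [k /eqP kj|_].
  have := Im0 j; rewrite -[c.2 0 j]conjcK -kj conjc_real.
  by rewrite eqxx.
case: pickP => [k /eqP kj|_].
  have /disj : (c.2 0 j)^* \in [seq (c.2 0 j)^* | j : 'I_s].
    by apply/mapP; exists j; rewrite ?mem_enum.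
  case/negP; rewrite -kj; apply/mapP; exists k; rewrite ?mem_enum//.
case: pickP => [k /eqP/inj -> //|/(_ j)].
by rewrite eqxx.
Qed.

Lemma kev_conjc y v : proper_conj x y -> kev c y^* v = (kev c y v)^*.
Proof.
case/proper_conjP => -[k ->].
- by rewrite conjc_real kev_real conjc_real.
- by rewrite kev_cplxJ kev_cplx.
- by rewrite conjcK kev_cplxJ kev_cplx conjcK.
Qed.

(** This lets identities in [Kspace] be checked at one conjugate at a time. *)
Lemma kev_ext v w : (forall y, proper_conj x y -> kev c y v = kev c y w) -> v = w.
Proof.
move=> H; case: v w H => [v1 v2] [w1 w2] H; congr (_, _); apply/rowP => k.
  by have := H _ (proper_real k); rewrite !kev_real => -[].
by have := H _ (proper_cplx k); rewrite !kev_cplx.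
Qed.

Lemma kev_psi y f : proper_conj x y -> kev c y (psi x c (evalq x f)) = evalq y f.
Proof.
move=> /proper_conjP[] [k ->].
- have [xk _] := proper_real k.
  by rewrite kev_real mxE (embeddingE_real xk (erefl _)) evalq_real.
- have [xk _] := proper_cplx k.
  by rewrite kev_cplx mxE (embeddingE xk (erefl _)).
- have [xk _] := proper_cplx k.
  by rewrite kev_cplxJ mxE (embeddingE xk (erefl _)) evalq_conjc.
Qed.

(** So the multiplication by [c] in [rauzy_map] is multiplication by the image of the generator. *)
Lemma psi_id : psi x c x = c.
Proof.
apply: kev_ext => y xy.
have -> : psi x c x = psi x c (evalq x 'X) by rewrite evalqX.
rewrite kev_psi// evalqX; case/proper_conjP : xy => -[k ->].
- by rewrite kev_real.
- by rewrite kev_cplx.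
- by rewrite kev_cplxJ.
Qed.

Lemma psiM z z' : number_field x z -> number_field x z' ->
  psi x c (z * z') = Kmul (psi x c z) (psi x c z').
Proof.
move=> [f ->] [g ->]; apply: kev_ext => y xy.
rewrite -![(ratpoly _ _).[_]]/(evalq _ _) -evalqM kevM !kev_psi//.
by rewrite evalqM.
Qed.

Lemma psiD z z' : number_field x z -> number_field x z' ->
  psi x c (z + z') = psi x c z + psi x c z'.
Proof.
move=> [f ->] [g ->]; apply: kev_ext => y xy.
rewrite -![(ratpoly _ _).[_]]/(evalq _ _) -evalqD kevD !kev_psi//.
by rewrite evalqD.
Qed.

End OneSystem.

Section Transfer.
Variables (x x' : R) (A B : {poly rat}).
Hypotheses (algx : algebraic x) (xA : x = evalq x' A) (x'B : x' = evalq x B).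

(** The relation saying that [B] undoes [A] at [x'] passes to each conjugate [y']. Hence [A] sends
    [y'] to [x] only when [y'] is [x']. *)
Lemma proper_transfer y' : proper_conj x' y' ->
  proper_conj x (evalq y' A) /\ evalq (evalq y' A) B = y'.
Proof.
move=> [xy' y'x'].
have BA : evalq (evalq y' A) B = y'.
  rewrite -evalq_comp -[RHS]evalqX; apply: (conj_evalq_eq xy').
  by rewrite evalq_comp -xA -x'B evalqX.
split=> //; split; first by rewrite {1}xA; apply: conj_evalq xy'; rewrite -xA.
by apply: contra_neq y'x' => yx; rewrite -BA yx evalq_real -x'B.
Qed.

Variables (r s r' s' : nat) (c : Kspace R r s) (c' : Kspace R r' s').
Hypotheses (cs : conjugate_system x c) (cs' : conjugate_system x' c').

(** The coordinate at [y'] is that of [v] at [A(y')]. For real [y'] this value is already real, so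
    [Re] loses nothing. *)
Definition Ktr (v : Kspace R r s) : Kspace R r' s' :=
  (\row_i complex.Re (kev c (evalq (c'.1 0 i)%:C A) v),
   \row_j kev c (evalq (c'.2 0 j) A) v).

Lemma kev_Ktr y' v : proper_conj x' y' -> kev c' y' (Ktr v) = kev c (evalq y' A) v.
Proof.
move=> xy'; have [xy _] := proper_transfer xy'.
have [] := proper_conjP cs' xy' => -[k yE]; rewrite yE in xy *.
- rewrite (kev_real cs') mxE RRe_real//.
  (* The index is fixed by complex conjugation, hence so is the coordinate. *)
  have := kev_conjc cs v xy; set z := evalq _ A.
  have -> : z^* = z.
    by rewrite /z -evalq_conjc; congr evalq; exact: conjc_real.
  case: kev => a b [ba]; rewrite complex_real; apply/eqP; lra.
- by rewrite (kev_cplx cs') mxE.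
- rewrite (kev_cplxJ cs') mxE evalq_conjc (kev_conjc cs)//.
  by have [] := proper_transfer (proper_cplx cs' k).
Qed.

Lemma Ktr_psi z : number_field x z -> Ktr (psi x c z) = psi x' c' z.
Proof.
move=> [f ->]; rewrite -[_.[_]]/(evalq x f).
apply: (kev_ext cs') => y' xy'; have [xy _] := proper_transfer xy'.
by rewrite kev_Ktr// (kev_psi cs)// xA -!evalq_comp (kev_psi cs').
Qed.

Lemma KtrM v w : Ktr (Kmul v w) = Kmul (Ktr v) (Ktr w).
Proof.
by apply: (kev_ext cs') => y' xy'; rewrite kevM !kev_Ktr// kevM.
Qed.

Lemma KtrD v w : Ktr (v + w) = Ktr v + Ktr w.
Proof.
by apply: (kev_ext cs') => y' xy'; rewrite kevD !kev_Ktr// kevD.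
Qed.

Lemma KtrZ a v : Ktr (a *: v) = a *: Ktr v.
Proof.
by apply: (kev_ext cs') => y' xy'; rewrite kevZ !kev_Ktr// kevZ.
Qed.

Lemma Ktr_le e v : 0 <= e -> Kle e v -> Kle e (Ktr v).
Proof.
move=> e0 ev; split=> k; rewrite mxE; last exact: kev_le.
by rewrite -lecR; apply: le_trans (normc_ge_Re _) _; exact: kev_le.
Qed.

End Transfer.

Lemma KtrK (x x' : R) A B r s r' s' (c : Kspace R r s) (c' : Kspace R r' s') :
  algebraic x -> algebraic x' -> x = evalq x' A -> x' = evalq x B ->
  conjugate_system x c -> conjugate_system x' c' ->
  cancel (Ktr A c c') (Ktr B c' c).
Proof.
move=> algx algx' xA x'B cs cs' v; apply: (kev_ext cs) => y xy.
have [xy' yE] := proper_transfer algx' x'B xA xy.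
by rewrite (kev_Ktr algx' x'B xA)// (kev_Ktr algx xA x'B)// yE.
Qed.

(** Every conjugate of [x'] other than [x'] is the value of [B] at a proper conjugate of [x]. *)
Lemma pisot_transfer (x x' : R) A B : algebraic x -> algebraic_integer x' ->
  1 < x' -> x = evalq x' A -> x' = evalq x B ->
  (forall y, proper_conj x y -> `|evalq y B| < 1) -> pisot x'.
Proof.
move=> algx intx' x'1 xA x'B H; split=> // y' xy' y'x'.
have [xy <-] := proper_transfer algx xA x'B (conj xy' y'x').
exact: H.
Qed.

End ConjugateCoordinates.

(** * The set equations of the tiles *)

Section TileRecursion.
Variables (V : comPzRingType) (q : nat) (a b : V) (F : set V).
Hypotheses (q2 : (2 <= q)%N) (abq : a = b ^+ q) (bq : b ^+ q = b ^+ (q - 1) + 1).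
Hypothesis FE : F = (fun f => a * f) @` F `|` (fun f => b * (1 - f)) @` F.

Let FL f : F f -> F (a * f).
Proof. by move=> Ff; rewrite FE; left; exists f. Qed.

Let FR f : F f -> F (b * (1 - f)).
Proof. by move=> Ff; rewrite FE; right; exists f. Qed.

Let Fcase f : F f -> (exists2 g, F g & f = a * g) \/ (exists2 g, F g & f = b * (1 - g)).
Proof. by rewrite {1}FE => -[[g Fg <-]|[g Fg <-]]; [left|right]; exists g. Qed.

(* The point of the tile with index [e] and orientation [neg] that has
   parameter [f] in [F]. *)
Definition tile_point (neg : bool) (e : nat) (f : V) : V :=
  let v := (if e == (q - 1)%N then 1 else a) * b ^+ e * f in
  if neg then b ^+ e - v else v.

(** Marks the letters whose tile is a reflected copy, of the form [minus_set], in [tile]. *)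
Definition letter_neg k := odd (letter_exp q k) (+) (q <= k)%N.

Let bS n : b * b ^+ n = b ^+ n.+1.
Proof. by rewrite exprS. Qed.

Let aE : a = b * b ^+ (q - 1).
Proof. by rewrite bS abq (_ : (q - 1).+1 = q)//; lia. Qed.

Let bbq : b * b ^+ (q - 1) = b ^+ (q - 1) + 1.
Proof. by rewrite -aE abq bq. Qed.

Lemma tile_point_lt neg e f : (e < q - 1)%N ->
  tile_point neg e f = if neg then b ^+ e - a * b ^+ e * f else a * b ^+ e * f.
Proof. by move=> eq; rewrite /tile_point ltn_eqF. Qed.

Lemma tile_point_top neg f : tile_point neg (q - 1) f =
  if neg then b ^+ (q - 1) - b ^+ (q - 1) * f else b ^+ (q - 1) * f.
Proof. by rewrite /tile_point eqxx mul1r. Qed.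

Lemma tile_up neg e f : (e.+1 < q - 1)%N ->
  b * tile_point neg e f = tile_point neg e.+1 f.
Proof.
move=> eq; rewrite !tile_point_lt//; last by lia.
by case: neg; rewrite exprS; ring.
Qed.

(** The tile of exponent [q - 1] has no factor [a] in its scale, so the factor [a] moves into the
    parameter. *)
Lemma tile_up_top neg e f : e.+1 = (q - 1)%N ->
  b * tile_point neg e f = tile_point neg (q - 1) (a * f).
Proof.
move=> eq; rewrite tile_point_top tile_point_lt -eq//.
by case: neg; rewrite exprS; ring.
Qed.

Lemma tile_pos_top f :
  b * tile_point false (q - 1) f = tile_point false 0 f.
Proof.
rewrite tile_point_top tile_point_lt; last by lia.
by rewrite expr0 aE; ring.
Qed.

(** The relation gives [-1 = b ^+ (q - 1) - b ^+ q], which turns the shift into a reflection. *)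
Lemma tile_pos_top_shift f :
  - 1 + b * tile_point false (q - 1) f = tile_point true (q - 1) (b * (1 - f)).
Proof.
rewrite !tile_point_top.
transitivity (b ^+ (q - 1) - (b * b ^+ (q - 1)) * (1 - f)); last by ring.
have -> : -1 = b ^+ (q - 1) - b * b ^+ (q - 1) by rewrite bbq; ring.
by ring.
Qed.

Lemma tile_neg_top f :
  b * tile_point true (q - 1) f = tile_point false (q - 1) (b * (1 - f)).
Proof. by rewrite !tile_point_top; ring. Qed.

Lemma tile_neg_top_shift f :
  - b ^+ (q - 1) + b * tile_point true (q - 1) f = tile_point true 0 f.
Proof.
rewrite tile_point_top tile_point_lt; last by lia.
rewrite expr0 aE.
transitivity (b * b ^+ (q - 1) - b ^+ (q - 1) - b * b ^+ (q - 1) * f).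
  by ring.
by rewrite {1}bbq; ring.
Qed.

(** The pairing of a prefix with the left eigenvector; it occurs negated because the tiles solve the
    equations for minus that eigenvector. *)
Definition word_shift (U : seq nat) : V := \sum_(n <- U) b ^+ letter_exp q n.

Definition letter_point k f := tile_point (letter_neg k) (letter_exp q k) f.

(** Gives continuity in the parameter, hence compactness of the tiles, without distinguishing
    letters. *)
Lemma letter_point_affine k :
  exists u v, letter_point k = (fun f => u + v * f).
Proof.
rewrite /letter_point /tile_point; case: letter_neg.
  by eexists _, (- _); apply/funext => f; rewrite mulNr.
by eexists 0, _; apply/funext => f; rewrite add0r.
Qed.

Lemma letter_point_lt k f : (k < q)%N -> letter_point k f = tile_point (odd k) k f.
Proof.
move=> kq; rewrite /letter_point /letter_neg /letter_exp kq leqNgt kq.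
by rewrite addbF.
Qed.

Lemma letter_point_ge k f : (q <= k)%N ->
  letter_point k f = tile_point (~~ odd (k - q)) (k - q) f.
Proof.
move=> kq; rewrite /letter_point /letter_neg /letter_exp kq ltnNge kq.
by rewrite addbT.
Qed.

Let word_shift0 : - word_shift [::] = 0.
Proof. by rewrite /word_shift big_nil oppr0. Qed.

Let word_shift1 : - word_shift [:: 0%N] = -1.
Proof. by rewrite /word_shift big_seq1 /letter_exp ifT ?expr0//; lia. Qed.

Let word_shift_top : - word_shift [:: q - 1]%N = - b ^+ (q - 1).
Proof. by rewrite /word_shift big_seq1 /letter_exp ifT//; lia. Qed.

(** The factor [b] is displayed so that it can be pulled out of a step by [b ^+ 2]. *)
Let word_shift2 : - word_shift [:: 0; q - 1]%N = b * (- b ^+ (q - 1)).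
Proof.
rewrite /word_shift !big_cons big_nil addr0 /letter_exp ifT; last by lia.
rewrite ifT; last by lia.
by rewrite mulrN bbq expr0 addrC.
Qed.

(* An occurrence [theta k = U x W] sends the tile of [k] into the tile of [x];
   [g] is its effect on the parameter in [F]. *)
Definition letter_arrow k (U : seq nat) x (g : V -> V) :=
  forall f, - word_shift U + theta_root q b * letter_point k f
    = letter_point x (g f).

(** Changing halves while raising the exponent by 1 preserves the orientation. For [k = q - 2] the
    target is the top tile, whence the factor [a]. *)
Lemma arrow_odd_up k : odd q -> (k <= q - 2)%N ->
  letter_arrow k [::] (q + k + 1) (if k == (q - 2)%N then (fun f => a * f) else id).
Proof.
move=> oq kq f; rewrite /theta_root oq word_shift0 add0r.
rewrite letter_point_lt; last by lia.
rewrite letter_point_ge; last by lia.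
have -> : (q + k + 1 - q = k.+1)%N by lia.
rewrite /= negbK; case: eqP => kq2.
  by rewrite kq2 (tile_up_top _ (e := q - 2)); [congr tile_point|]; lia.
by rewrite tile_up//; lia.
Qed.

Lemma arrow_odd_down k : odd q -> (k <= q - 2)%N ->
  letter_arrow (q + k) [::] (k + 1) (if k == (q - 2)%N then (fun f => a * f) else id).
Proof.
move=> oq kq f; rewrite /theta_root oq word_shift0 add0r.
rewrite letter_point_ge; last by lia.
rewrite letter_point_lt; last by lia.
have -> : (q + k - q = k)%N by lia.
rewrite addn1 /=; case: eqP => kq2.
  by rewrite kq2 (tile_up_top _ (e := q - 2)); [congr tile_point|]; lia.
by rewrite tile_up//; lia.
Qed.

Lemma arrow_odd_top : odd q ->
  letter_arrow (q - 1) [::] 0 id /\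
  letter_arrow (q - 1) [:: 0]%N (2 * q - 1) (fun f => b * (1 - f)).
Proof.
move=> oq; split=> f; rewrite /theta_root oq ?word_shift0 ?word_shift1 ?add0r.
  rewrite !letter_point_lt; [|by lia..].
  by rewrite (_ : odd (q - 1) = false) ?tile_pos_top//; lia.
rewrite letter_point_lt; last by lia.
rewrite letter_point_ge; last by lia.
rewrite (_ : odd (q - 1) = false); last by lia.
rewrite tile_pos_top_shift; congr tile_point; lia.
Qed.

Lemma arrow_odd_last : odd q ->
  letter_arrow (2 * q - 1) [::] (q - 1) (fun f => b * (1 - f)) /\
  letter_arrow (2 * q - 1) [:: q - 1]%N q id.
Proof.
move=> oq; split=> f; rewrite /theta_root oq ?word_shift0 ?word_shift_top ?add0r.
  rewrite letter_point_ge; last by lia.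
  rewrite letter_point_lt; last by lia.
  rewrite (_ : 2 * q - 1 - q = q - 1)%N; last by lia.
  by rewrite (_ : odd (q - 1) = false) ?tile_neg_top//; lia.
rewrite !letter_point_ge; [|by lia..].
rewrite (_ : 2 * q - 1 - q = q - 1)%N; last by lia.
rewrite (_ : odd (q - 1) = false); last by lia.
by rewrite tile_neg_top_shift subnn.
Qed.

Lemma arrow_even_up k : ~~ odd q -> (k + 3 <= q)%N ->
  letter_arrow k [::] (k + 2) (if k == (q - 3)%N then (fun f => a * f) else id).
Proof.
move=> oq kq f; rewrite /theta_root (negbTE oq) word_shift0 add0r.
rewrite !letter_point_lt; [|by lia..].
rewrite expr2 -mulrA tile_up; last by lia.
rewrite addn2 /= negbK; case: eqP => kq2.
  by rewrite tile_up_top; [congr tile_point|]; lia.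
by rewrite tile_up//; lia.
Qed.

Lemma arrow_even_top : ~~ odd q ->
  letter_arrow (q - 2) [::] 0 (fun f => a * f) /\
  letter_arrow (q - 2) [:: 0]%N (q - 1) (fun f => b * (1 - a * f)).
Proof.
move=> oq; have oq2 : odd (q - 2) = false by lia.
split=> f; rewrite /theta_root (negbTE oq) ?word_shift0 ?word_shift1 ?add0r.
  rewrite !letter_point_lt; [|by lia..].
  rewrite oq2 expr2 -mulrA tile_up_top; last by lia.
  by rewrite tile_pos_top.
rewrite !letter_point_lt; [|by lia..].
rewrite oq2 expr2 -mulrA tile_up_top; last by lia.
by rewrite tile_pos_top_shift (_ : odd (q - 1))//; lia.
Qed.

(** For [q = 2] the letter 1 is itself the top letter [q - 1], whence the separate case of the third
    arrow. *)
Lemma arrow_even_last : ~~ odd q ->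
  [/\ letter_arrow (q - 1) [::] 0 (fun f => b * (1 - f)),
      letter_arrow (q - 1) [:: 0]%N (q - 1) (fun f => b * (1 - b * (1 - f))) &
      letter_arrow (q - 1) [:: 0; q - 1]%N 1
        (if q == 2%N then (fun f => a * f) else id)].
Proof.
move=> oq; have oq1 : odd (q - 1) by lia.
split=> f; rewrite /theta_root (negbTE oq) ?word_shift0 ?word_shift1 ?word_shift2 ?add0r.
- rewrite !letter_point_lt; [|by lia..].
  by rewrite oq1 expr2 -mulrA tile_neg_top tile_pos_top.
- rewrite !letter_point_lt; [|by lia..].
  by rewrite oq1 expr2 -mulrA tile_neg_top tile_pos_top_shift.
- rewrite !letter_point_lt; [|by lia..].
  rewrite oq1 expr2 -mulrA -mulrDr tile_neg_top_shift.
  case: eqP => q2E.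
    by rewrite tile_up_top; [congr tile_point|]; lia.
  by rewrite tile_up//; lia.
Qed.

Lemma tile_step k U x W f : (k < (theta_max q).+1)%N ->
  theta_word q k = U ++ x :: W -> F f ->
  exists2 g, F g & - word_shift U + theta_root q b * letter_point k f
    = letter_point x g.
Proof.
have by_arrow k' U' x' (g : V -> V) : letter_arrow k' U' x' g -> F (g f) ->
    exists2 g, F g & - word_shift U' + theta_root q b * letter_point k' f
      = letter_point x' g.
  by move=> ar Fg; exists (g f).
rewrite theta_sizeE// /theta_word; case: ifP => [oq|/negbT oq] kN kE Ff.
  move: kE; rewrite /theta_odd; case: ifP => [k1|/negbT k1].
    case: U => [|? []] // [<- _].
    by apply: by_arrow _ _ _ _ (arrow_odd_up oq k1) _; case: eqP => _; [exact: FL|].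
  case: ifP => [/eqP kE|/negbT k2].
    rewrite kE.
    have [A1 A2] := arrow_odd_top oq.
    case: U => [|? [|? []]] // [].
      by move=> <- _; exact: by_arrow _ _ _ _ A1 Ff.
    by move=> <- <- _; exact: by_arrow _ _ _ _ A2 (FR Ff).
  case: ifP => [k3|/negbT k3].
    case: U => [|? []] // [<- _].
    have := @arrow_odd_down (k - q)%N oq.
    rewrite (_ : (q + (k - q) = k)%N); last by lia.
    move=> /(_ ltac:(lia)) A; apply: by_arrow _ _ _ _ A _.
    by case: eqP => _; [exact: FL|].
  have kE : k = (2 * q - 1)%N by lia.
  rewrite kE.
  have [A1 A2] := arrow_odd_last oq.
  case: U => [|? [|? []]] // [].
    by move=> <- _; exact: by_arrow _ _ _ _ A1 (FR Ff).
  by move=> <- <- _; exact: by_arrow _ _ _ _ A2 Ff.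
move: kE; rewrite /theta_even; case: ifP => [k1|/negbT k1].
  case: U => [|? []] // [<- _].
  by apply: by_arrow _ _ _ _ (arrow_even_up oq k1) _; case: eqP => _; [exact: FL|].
case: ifP => [/eqP kE|/negbT k2].
  rewrite kE.
  have [A1 A2] := arrow_even_top oq.
  case: U => [|? [|? []]] // [].
    by move=> <- _; exact: by_arrow _ _ _ _ A1 (FL Ff).
  by move=> <- <- _; exact: by_arrow _ _ _ _ A2 (FR (FL Ff)).
have kE : k = (q - 1)%N by lia.
rewrite kE.
have [A1 A2 A3] := arrow_even_last oq.
case: U => [|? [|? [|? []]]] // [].
- by move=> <- _; exact: by_arrow _ _ _ _ A1 (FR Ff).
- by move=> <- <- _; exact: by_arrow _ _ _ _ A2 (FR (FR Ff)).
- by move=> <- <- <- _; apply: by_arrow _ _ _ _ A3 _; case: eqP => _; [exact: FL|].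
Qed.

(** A letter with a single occurrence receives all of [F]. For the others, [F] is split into [a F]
    and [b (1 - F)], one piece per occurrence. For even [q] the letter [q - 1] has three
    occurrences, and [F] inside [b (1 - F)] is split once more. *)
Lemma tile_cover x f : (x < (theta_max q).+1)%N -> F f ->
  exists k U W g, [/\ (k < (theta_max q).+1)%N, theta_word q k = U ++ x :: W,
    F g & letter_point x f = - word_shift U + theta_root q b * letter_point k g].
Proof.
rewrite theta_sizeE// /theta_word => xN Ff.
have by_arrow k U W g (h : V -> V) : (k < if odd q then 2 * q else q)%N ->
    (if odd q then theta_odd else theta_even) q k = U ++ x :: W ->
    letter_arrow k U x h -> F g -> f = h g ->
    exists k U W g, [/\ (k < if odd q then 2 * q else q)%N,
    (if odd q then theta_odd else theta_even) q k = U ++ x :: W,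
    F g & letter_point x f = - word_shift U + theta_root q b * letter_point k g].
  by move=> kN kE ar Fg fE; exists k, U, W, g; split=> //; rewrite ar fE.
move: xN by_arrow; case: ifP => [oq|/negbT oq] xN by_arrow.
  have up k : (k <= q - 2)%N -> theta_odd q k = [::] ++ [:: q + k + 1]%N.
    by move=> kq; rewrite /theta_odd kq.
  have top : theta_odd q (q - 1) = [:: 0; 2 * q - 1]%N.
    by rewrite /theta_odd ifF ?eqxx//; lia.
  have down k : (k <= q - 2)%N -> theta_odd q (q + k) = [::] ++ [:: k + 1]%N.
    move=> kq; rewrite /theta_odd ifF; last by lia.
    rewrite ifF; last by lia.
    by rewrite ifT; [rewrite addKn|lia].
  have lastE : theta_odd q (2 * q - 1) = [:: q - 1; q]%N.
    rewrite /theta_odd ifF; last by lia.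
    by rewrite ifF ?ifF//; lia.
  have [T1 T2] := arrow_odd_top oq; have [L1 L2] := arrow_odd_last oq.
  have [x0|x0] := eqVneq x 0%N.
    rewrite x0 in by_arrow *.
    by apply: (by_arrow (q - 1) [::] [:: 2 * q - 1] f _ _ _ T1)%N => //; lia.
  have [xq|xq] := eqVneq x q.
    rewrite xq in by_arrow *.
    by apply: (by_arrow (2 * q - 1) [:: q - 1] [::] f _ _ _ L2)%N => //; lia.
  have [xq1|xq1] := eqVneq x (q - 1)%N.
    rewrite xq1 in by_arrow *.
    have [[g Fg fE]|[g Fg fE]] := Fcase Ff.
      have := @arrow_odd_down (q - 2)%N oq (leqnn _).
      have := down (q - 2)%N (leqnn _); rewrite eqxx.
      rewrite (_ : (q - 2 + 1 = q - 1)%N); last by lia.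
      move=> D1 D2; apply: (by_arrow _ _ _ _ _ _ D1 D2 Fg fE); lia.
    by apply: (by_arrow (2 * q - 1) [::] [:: q] g _ _ _ L1)%N => //; lia.
  have [xl|xl] := eqVneq x (2 * q - 1)%N.
    rewrite xl in by_arrow *.
    have [[g Fg fE]|[g Fg fE]] := Fcase Ff.
      have := @arrow_odd_up (q - 2)%N oq (leqnn _).
      have := up (q - 2)%N (leqnn _); rewrite eqxx.
      rewrite (_ : (q + (q - 2) + 1 = 2 * q - 1)%N); last by lia.
      move=> D1 D2; apply: (by_arrow _ _ _ _ _ _ D1 D2 Fg fE); lia.
    by apply: (by_arrow (q - 1) [:: 0] [::] g _ _ _ T2)%N => //; lia.
  case: (ltnP x q) => xq'.
    have := @arrow_odd_down (x - 1)%N oq ltac:(lia).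
    have := down (x - 1)%N ltac:(lia); rewrite ifF; last by lia.
    rewrite (_ : (x - 1 + 1 = x)%N); last by lia.
    move=> D1 D2; apply: (by_arrow _ _ _ _ _ _ D1 D2 Ff) => //; lia.
  have := @arrow_odd_up (x - q - 1)%N oq ltac:(lia).
  have := up (x - q - 1)%N ltac:(lia); rewrite ifF; last by lia.
  rewrite (_ : (q + (x - q - 1) + 1 = x)%N); last by lia.
  move=> D1 D2; apply: (by_arrow _ _ _ _ _ _ D1 D2 Ff) => //; lia.
have up k : (k + 3 <= q)%N -> theta_even q k = [::] ++ [:: k + 2]%N.
  by move=> kq; rewrite /theta_even kq.
have top : theta_even q (q - 2) = [:: 0; q - 1]%N.
  by rewrite /theta_even ifF ?eqxx//; lia.
have lastE : theta_even q (q - 1) = [:: 0; q - 1; 1]%N.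
  rewrite /theta_even ifF; last by lia.
  by rewrite ifF//; lia.
have [T1 T2] := arrow_even_top oq; have [L1 L2 L3] := arrow_even_last oq.
have [x0|x0] := eqVneq x 0%N.
  rewrite x0 in by_arrow *.
  have [[g Fg fE]|[g Fg fE]] := Fcase Ff.
    by apply: (by_arrow (q - 2) [::] [:: q - 1] g _ _ _ T1)%N => //; lia.
  by apply: (by_arrow (q - 1) [::] [:: q - 1; 1] g _ _ _ L1)%N => //; lia.
have [xl|xl] := eqVneq x (q - 1)%N.
  rewrite xl in by_arrow *.
  have [[g Fg fE]|[g Fg fE]] := Fcase Ff.
    (* There is no letter [q - 3] when [q = 2]; the piece [a F] then comes from the last letter of
       the image of 1. *)
    have [q2E|qn2] := eqVneq q 2%N.
      have q1 : (q - 1 = 1)%N by lia.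
      apply: (by_arrow (q - 1)%N [:: 0; q - 1]%N [::] g (fun f => a * f)) => //.
      - lia.
      - by rewrite lastE q1.
      - by rewrite {3}q1; move: L3; rewrite q2E.
    have := @arrow_even_up (q - 3)%N oq ltac:(lia).
    have := up (q - 3)%N ltac:(lia); rewrite eqxx.
    rewrite (_ : (q - 3 + 2 = q - 1)%N); last by lia.
    move=> D1 D2; apply: (by_arrow _ _ _ _ _ _ D1 D2 Fg fE); lia.
  have [[h Fh gE]|[h Fh gE]] := Fcase Fg; rewrite gE in fE.
    by apply: (by_arrow (q - 2) [:: 0] [::] h _ _ _ T2)%N => //; lia.
  by apply: (by_arrow (q - 1) [:: 0] [:: 1] h _ _ _ L2)%N => //; lia.
have [x1|x1] := eqVneq x 1%N.
  rewrite x1 in by_arrow xl *; move: L3; rewrite ifF; last by lia.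
  move=> L3.
  by apply: (by_arrow (q - 1) [:: 0; q - 1] [::] f _ _ _ L3)%N => //; lia.
have := @arrow_even_up (x - 2)%N oq ltac:(lia).
have := up (x - 2)%N ltac:(lia); rewrite ifF; last by lia.
rewrite (_ : (x - 2 + 2 = x)%N); last by lia.
move=> D1 D2; apply: (by_arrow _ _ _ _ _ _ D1 D2 Ff) => //; lia.
Qed.

End TileRecursion.

(* An alias of [Kspace], which itself gets no ring structure. *)
Definition Kring (R : realType) (r s : nat) : Type := Kspace R r s.

Section KringStructure.
Variables (R : realType) (r s : nat).

HB.instance Definition _ := GRing.Zmodule.copy (Kring R r s) (Kspace R r s).

Let mulA : associative (@Kmul R r s).
Proof. by move=> x y z; congr (_, _); apply/rowP => k; rewrite !mxE mulrA. Qed.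

Let mulC : commutative (@Kmul R r s).
Proof. by move=> x y; congr (_, _); apply/rowP => k; rewrite !mxE mulrC. Qed.

Let mul1 : left_id (const_mx 1, const_mx 1) (@Kmul R r s).
Proof. by case=> x y; congr (_, _); apply/rowP => k; rewrite !mxE mul1r. Qed.

Let mulDl : left_distributive (@Kmul R r s) +%R.
Proof. by move=> x y z; congr (_, _); apply/rowP => k; rewrite !mxE mulrDl. Qed.

HB.instance Definition _ := GRing.Zmodule_isComPzRing.Build (Kring R r s)
  mulA mulC mul1 mulDl.

End KringStructure.

(** * Multiplicativity of [psi] and the tiles as affine images of the tent-tile *)

Section PsiRing.
Variables (R : realType) (r s : nat) (x : R) (c : Kspace R r s).
Hypothesis cs : conjugate_system x c.

Let psi_ z : Kring R r s := psi x c z.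

Lemma psi1 : psi_ 1 = 1.
Proof.
have psi1E : psi x c 1 = psi x c (evalq x 1) by rewrite evalq1.
apply: (kev_ext cs) => y xy; rewrite /psi_ psi1E (kev_psi cs)// evalq1.
have [] := proper_conjP cs xy => -[k ->].
- by rewrite (kev_real cs) mxE.
- by rewrite (kev_cplx cs) mxE.
- by rewrite (kev_cplxJ cs) mxE conjc1.
Qed.

Lemma psiX z n : number_field x z -> psi_ (z ^+ n) = psi_ z ^+ n.
Proof.
move=> xz; elim: n => [|n IH]; first by rewrite !expr0 psi1.
rewrite !exprS -IH; apply: (psiM cs xz); exact: numfieldX.
Qed.

Lemma psi0 : psi_ 0 = 0.
Proof.
have x0 := numfield0 x; have : psi_ (0 + 0) = psi_ 0 + psi_ 0 := psiD cs x0 x0.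
by rewrite addr0 => h; apply: (addrI (psi_ 0)); rewrite addr0 -h.
Qed.

Lemma psiN z : number_field x z -> psi_ (- z) = - psi_ z.
Proof.
move=> xz; have xNz := numfieldN xz; apply: (addIr (psi_ z)).
have : psi_ (- z + z) = psi_ (- z) + psi_ z := psiD cs xNz xz.
by rewrite !addNr psi0.
Qed.

Lemma psi_sum (I : Type) (l : seq I) (f : I -> R) :
  (forall i, number_field x (f i)) ->
  psi_ (\sum_(i <- l) f i) = \sum_(i <- l) psi_ (f i).
Proof.
move=> xf; elim: l => [|i l IH]; first by rewrite !big_nil psi0.
by rewrite !big_cons -IH; apply: (psiD cs) => //; exact: numfield_sum.
Qed.

End PsiRing.

Section TileRing.
Variables (R : realType) (r s : nat) (alpha : R) (c : Kspace R r s).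
Variables (F : set (Kspace R r s)) (q : nat).
Hypotheses (q2 : (2 <= q)%N) (cs : conjugate_system alpha c).
Let beta := alpha / (alpha - 1).
Hypothesis beta_field : number_field alpha beta.
Let a : Kring R r s := psi alpha c alpha.
Let b : Kring R r s := psi alpha c beta.

(** Replaces the case distinctions of [tile] by the uniform parametrization used for the set
    equations. *)
Lemma tileE k : (k < (theta_max q).+1)%N ->
  tile alpha c F q k = letter_point q a b k @` (F : set (Kring R r s)).
Proof.
have pX n : psi alpha c (beta ^+ n) = b ^+ n := psiX cs n beta_field.
have pM n : psi alpha c (alpha * beta ^+ n) = a * b ^+ n.
  by rewrite -pX; apply: (psiM cs); [exact: numfield_id|exact: numfieldX].
have minusE (u v : Kring R r s) :
    minus_set u (Kmul v @` F) = (fun f => u - v * f) @` (F : set (Kring R r s)).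
  by rewrite /minus_set image_comp.
rewrite theta_sizeE// /tile => kN.
case: ifP kN => [oq|/negbT oq] kN.
  rewrite /tile_odd; case: ifP => [k1|/negbT k1].
    have -> : letter_point q a b k = tile_point q a b (odd k) k.
      by apply/funext => f; rewrite letter_point_lt//; lia.
    rewrite /tile_point ltn_eqF; last by lia.
    by case: ifP => _; rewrite /Psi -/beta ?pX pM// minusE.
  case: ifP => [/eqP ->|/negbT k2].
    have -> : letter_point q a b (q - 1) = tile_point q a b false (q - 1).
      apply/funext => f; rewrite letter_point_lt//; last by lia.
      by congr tile_point; lia.
    rewrite /tile_point eqxx /Psi -/beta pX.
    by under [in RHS]eq_imagel do rewrite mul1r.
  case: ifP => [k3|/negbT k3].
    have -> : letter_point q a b k = tile_point q a b (~~ odd (k - q)) (k - q).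
      by apply/funext => f; rewrite letter_point_ge//; lia.
    rewrite /tile_point ltn_eqF; last by lia.
    by case: ifP => _; rewrite /Psi -/beta ?pX pM// minusE.
  have -> : letter_point q a b k = tile_point q a b true (q - 1).
    apply/funext => f; rewrite letter_point_ge//; last by lia.
    by congr tile_point; lia.
  rewrite /tile_point eqxx /Psi -/beta pX minusE.
  by under [in RHS]eq_imagel do rewrite mul1r.
rewrite /tile_even; case: ifP => [k1|/negbT k1].
  have -> : letter_point q a b k = tile_point q a b (odd k) k.
    by apply/funext => f; rewrite letter_point_lt//; lia.
  rewrite /tile_point ltn_eqF; last by lia.
  by case: ifP => _; rewrite /Psi -/beta ?pX pM// minusE.
have -> : letter_point q a b k = tile_point q a b true (q - 1).
  apply/funext => f; rewrite letter_point_lt//.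
  by congr tile_point; lia.
rewrite /tile_point eqxx /Psi -/beta pX minusE.
by under [in RHS]eq_imagel do rewrite mul1r.
Qed.

Lemma psi_word_shift U :
  psi alpha c (word_shift q beta U) = word_shift q b U.
Proof.
rewrite /word_shift.
have -> := psi_sum cs (f := fun n => beta ^+ letter_exp q n) U.
  by apply: eq_bigr => n _; exact: (psiX cs).
by move=> n; exact: numfieldX.
Qed.

End TileRing.

(** * The images of the tiles form a Rauzy fractal *)

Section RauzyTiles.
Local Open Scope complex_scope.
Variables (R : realType) (alpha : R) (q : nat).
Hypothesis q2 : (2 <= q)%N.
Let beta := alpha / (alpha - 1).
Let lam := theta_root q beta.
Hypotheses (alg_alpha : algebraic alpha) (alg_lam : algebraic lam).
Hypotheses (b1 : 1 < beta) (abq : alpha = beta ^+ q)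
  (bq : beta ^+ q = beta ^+ (q - 1) + 1).
Variables (A B : {poly rat}).
Hypotheses (alphaA : alpha = evalq lam A) (lamB : lam = evalq alpha B).
Hypothesis beta_field : number_field alpha beta.

Variables (r s : nat) (c : Kspace R r s) (F : set (Kspace R r s)).
Variables (r' s' : nat) (c' : Kspace R r' s').
Variable nu : 'rV[R]_(theta_max q).+1.
Hypotheses (cs : conjugate_system alpha c) (tent : tent_tile alpha c F).
Hypotheses (cs' : conjugate_system lam c') (PF : left_PF_vector (theta q) lam nu).

Let t := nu 0 ord0.

(* The left eigenvector for which the tiles themselves solve the equation of
   the Rauzy fractal is minus the one with entries [beta ^+ letter_exp q k]. *)
Definition rauzy_iso (v : Kspace R r s) : Kspace R r' s' :=
  Kmul (psi lam c' (- t)) (Ktr A c c' v).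

Let a : Kring R r s := psi alpha c alpha.
Let b : Kring R r s := psi alpha c beta.

Let t0 : t != 0.
Proof. by have [_ /(_ ord0) t0 _] := PF; rewrite gt_eqF. Qed.

Let t_field : number_field lam t.
Proof. by have [_ _ /(_ ord0)] := PF. Qed.

Lemma rauzy_iso_linear : linear rauzy_iso.
Proof.
move=> k v w; rewrite /rauzy_iso (KtrD alg_alpha alphaA lamB cs cs').
rewrite (KtrZ alg_alpha alphaA lamB cs cs').
congr (_, _); apply/rowP => i; rewrite !mxE mulrDr; congr (_ + _).
  by rewrite mulrCA.
by rewrite mulrCA.
Qed.

Lemma rauzy_iso_bij : bijective rauzy_iso.
Proof.
have Nt : number_field lam (- t) := numfieldN t_field.
have NtV : number_field lam (- t)^-1 := numfieldV alg_lam Nt.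
have tt : Kmul (psi lam c' (- t)^-1) (psi lam c' (- t)) = (1 : Kring R r' s').
  by rewrite -(psiM cs' NtV Nt) mulVf ?oppr_eq0// (psi1 cs').
exists (fun w => Ktr B c' c (Kmul (psi lam c' (- t)^-1) w)) => v.
  rewrite /rauzy_iso.
  have -> : Kmul (psi lam c' (- t)^-1) (Kmul (psi lam c' (- t)) (Ktr A c c' v))
      = Ktr A c c' v.
    by rewrite [LHS](mulrA (_ : Kring R r' s')) [X in X * _]tt mul1r.
  exact: (KtrK alg_alpha alg_lam alphaA lamB cs cs').
rewrite /rauzy_iso (KtrK alg_lam alg_alpha lamB alphaA cs' cs).
rewrite [LHS](mulrA (_ : Kring R r' s')).
by rewrite [X in X * _](mulrC (_ : Kring R r' s')) [X in X * _]tt mul1r.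
Qed.

Lemma rauzy_iso_continuous (u w : Kring R r s) :
  continuous (fun f : Kspace R r s => rauzy_iso (u + w * f)).
Proof.
have [e e0 ep] := Kle_exists (psi lam c' (- t)).
have [e' e0' ew] := Kle_exists (w : Kspace R r s).
apply: (@Lipschitz_continuous R _ _ _ _ (e * e')); first exact: mulr_ge0.
move=> d x y d0 xy.
have -> : rauzy_iso (u + w * x) - rauzy_iso (u + w * y)
    = Kmul (psi lam c' (- t)) (Ktr A c c' (Kmul w (x - y))).
  transitivity (rauzy_iso (-1 *: (u + w * y) + (u + w * x))).
    by rewrite rauzy_iso_linear scaleN1r addrC.
  congr (Kmul _ (Ktr _ _ _ _)); rewrite scaleN1r KmulBr opprD.
  by rewrite addrACA addNr add0r addrC.
rewrite -mulrA; apply: KleM => //; apply: Ktr_le => //.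
  exact: mulr_ge0.
exact: KleM.
Qed.

(** By [left_PF_theta] the translation vector is [- t] times minus the word shift, and
    multiplication by [c'] corresponds under [Ktr] to multiplication by the image of [lam]. The
    common factor [psi lam c' (- t)] then comes out. *)
Lemma rauzy_map_iso U v :
  rauzy_map lam c' nu U (rauzy_iso v) =
  rauzy_iso ((- word_shift q b (map val U) : Kring R r s)
             + theta_root q b * (v : Kring R r s)).
Proof.
have nuE : forall k, nu 0 k = beta ^+ letter_exp q k * t.
  by apply: (left_PF_theta q2 b1 bq); have [] := PF.
have wf : number_field alpha (word_shift q beta (map val U)).
  by apply: numfield_sum => n; exact: numfieldX.
have wNf := numfieldN wf.
have wNf' : number_field lam (- word_shift q beta (map val U)).
  have [f ->] := wNf; exists (f \Po A).
  by rewrite -[RHS]/(evalq _ _) evalq_comp -alphaA.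
have lam_field : number_field alpha lam by exists B.
have rootE : theta_root q b = psi alpha c lam.
  rewrite /theta_root /lam /theta_root; case: ifP => // _.
  by rewrite -(psiX cs).
rewrite /rauzy_map mulmx_abelianization.
have -> : \sum_(k <- U) nu 0 k = (- t) * (- word_shift q beta (map val U)).
  rewrite mulrNN mulrC /word_shift big_map mulr_suml.
  by apply: eq_bigr => k _; rewrite nuE.
rewrite (psiM cs' (numfieldN t_field) wNf').
rewrite -(Ktr_psi alg_alpha alphaA lamB cs cs' wNf) (psiN cs wf) (psi_word_shift _ cs beta_field).
rewrite /rauzy_iso (KtrD alg_alpha alphaA lamB cs cs').
have c'E : c' = Ktr A c c' (theta_root q b).
  by rewrite rootE (Ktr_psi alg_alpha alphaA lamB cs cs' lam_field) psi_id.
rewrite [X in Kmul X (Kmul _ _)]c'E.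
have -> : Ktr A c c' (theta_root q b * (v : Kring R r s)) =
  Kmul (Ktr A c c' (theta_root q b)) (Ktr A c c' v)
  := KtrM alg_alpha alphaA lamB cs cs' _ _.
rewrite [RHS](mulrDr (_ : Kring R r' s')); congr (_ + _).
exact: (mulrCA (_ : Kring R r' s')).
Qed.

Lemma rauzy_fractal_tiles :
  rauzy_fractal (theta q) lam c' nu (fun k => rauzy_iso @` tile alpha c F q k).
Proof.
have [F0 cF FE] := tent.
have FE' : (F : set (Kring R r s)) =
    (fun f : Kring R r s => a * f) @` F `|`
    (fun f : Kring R r s => b * (1 - f)) @` F.
  by rewrite {1}FE; congr (_ `|` _); rewrite /Psi (psi1 cs).
have abq' : a = b ^+ q by rewrite -(psiX cs)// -abq.
have bq' : b ^+ q = b ^+ (q - 1) + 1.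
  rewrite -!(psiX cs)// bq -(psi1 cs); apply: (psiD cs); last exact: numfield1.
  exact: numfieldX.
move=> k; rewrite tileE//; split.
- by case: F0 => f Ff; exists (rauzy_iso (letter_point q a b k f)); do 2!apply: imageP.
- have [u [w ->]] := letter_point_affine q a b k.
  rewrite image_comp.
  apply: (@continuous_compact _ _ (fun f : Kspace R r s => rauzy_iso (u + w * f)) F) => //.
  by apply: continuous_subspaceT; exact: rauzy_iso_continuous.
- apply/seteqP; split=> [_ [_ [f Ff <-] <-]|_ [[[l U] W] /= lE [w + <-]]].
    have [l [U [W [g [lN lE Fg ->]]]]] := tile_cover q2 abq' bq' FE' (ltn_ord k) Ff.
    exists (inord l, map inord U, map inord W) => /=.
      rewrite /theta inordK// -/(theta_word q l) lE map_cat /=.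
      by rewrite inord_val.
    exists (rauzy_iso (letter_point q a b l g)).
      by rewrite tileE// inordK//; do 2!apply: imageP.
    rewrite rauzy_map_iso; congr (rauzy_iso (- word_shift q b _ + _)).
    rewrite -map_comp -[RHS]map_id; apply/eq_in_map => n nU /=.
    by rewrite inordK// (theta_word_lt q2 lN)// lE mem_cat nU.
  move=> [v]; rewrite tileE// => -[f Ff <-] <-.
  have := val_theta q2 l; rewrite lE map_cat /= => /esym lE'.
  have [g Fg gE] := tile_step q2 abq' bq' FE' (ltn_ord l) lE' Ff.
  by rewrite rauzy_map_iso gE; do 2!apply: imageP.
Qed.

End RauzyTiles.

(** * Arithmetic of a special Pisot unit that is a power of [beta] *)

Section SpecialPisotPower.
Local Open Scope complex_scope.
Variables (R : realType) (alpha : R) (q : nat).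
Let beta := alpha / (alpha - 1).
Hypotheses (special : special_pisot_unit alpha) (abq : alpha = beta ^+ q).
Let lam := theta_root q beta.

Lemma special_beta_gt1 : 1 < beta.
Proof. by have [_ _ [_]] := special. Qed.

(** From [beta * (alpha - 1) = alpha] one gets [beta ^+ q.+1 = beta ^+ q + beta]; then [beta] is
    cancelled. *)
Lemma special_beta_rec : (2 <= q)%N -> beta ^+ q = beta ^+ (q - 1) + 1.
Proof.
move=> q2; have b1 := special_beta_gt1; have b0 : beta != 0.
  by rewrite gt_eqF// (lt_trans ltr01 b1).
have a1 : alpha - 1 != 0 by rewrite subr_eq0 abq gt_eqF// exprn_egt1//; lia.
have : beta * (alpha - 1) = alpha by rewrite /beta divfK.
rewrite mulrBr mulr1 => /eqP; rewrite subr_eq {1 2}abq => /eqP abE.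
apply: (mulfI b0); rewrite abE mulrDr mulr1 -exprS; congr (_ ^+ _ + _); lia.
Qed.

Lemma special_alpha_algebraic : algebraic alpha.
Proof. by apply: algebraic_integer_algebraic; have [[]] := special. Qed.

Lemma special_beta_integer : algebraic_integer beta.
Proof. by have [_ _ []] := special. Qed.

Lemma special_lam_integer : algebraic_integer lam.
Proof.
rewrite /lam /theta_root; case: ifP => _; first exact: special_beta_integer.
by rewrite expr2; apply: integral_mul; exact: special_beta_integer.
Qed.

Lemma special_beta_field x : algebraic x -> number_field x alpha ->
  number_field x beta.
Proof.
move=> algx xa; apply: numfieldM => //; apply: numfieldV => //.
by apply: numfieldB => //; exact: numfield1.
Qed.

Lemma special_alpha_field : number_field lam alpha.
Proof.
rewrite abq /lam /theta_root; case: ifP => [oq|/negbT oq].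
  by apply: numfieldX; exact: numfield_id.
rewrite (_ : q = 2 * q./2)%N; last by lia.
by rewrite exprM; apply: numfieldX; exact: numfield_id.
Qed.

(** For even [q], [alpha] is a power of [lam = beta ^+ 2], so [beta = alpha / (alpha - 1)] lies in
    the field of [lam]. The other conjugates of [lam] are therefore squares of conjugates of [beta]
    other than [beta]. *)
Lemma special_lam_pisot : pisot lam.
Proof.
have [_ _ pb] := special; rewrite /lam /theta_root; case: ifP => // /negbT oq.
have lamE : lam = beta ^+ 2 by rewrite /lam /theta_root (negbTE oq).
have algl : algebraic lam := algebraic_integer_algebraic special_lam_integer.
have [A bA] : number_field lam beta.
  exact: special_beta_field algl special_alpha_field.
rewrite -lamE; apply: (@pisot_transfer R beta lam A ('X * 'X)) => //.
- exact: algebraic_integer_algebraic special_beta_integer.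
- exact: special_lam_integer.
- by rewrite lamE exprn_egt1// special_beta_gt1.
- by rewrite evalqM evalqX lamE expr2.
- move=> y [xy yb]; have [_ _ H] := pb.
  by rewrite evalqM evalqX normrM mulr_ilt1// H.
Qed.

Lemma conjugate_system_lt1 r s (c : Kspace R r s) : conjugate_system lam c ->
  (forall i, `|c.1 0 i| < 1) /\ (forall j, `|c.2 0 j| < 1).
Proof.
move=> cs; have [_ _ H] := special_lam_pisot; split=> k.
  have [ck ckl] := proper_real cs k; have := H _ ck ckl.
  by rewrite normc_def /= expr0n addr0 sqrtr_sqr -[1]/(1%:C) ltcR.
by have [ck ckl] := proper_cplx cs k; exact: H.
Qed.

End SpecialPisotPower.

Unset Implicit Arguments.

Theorem theorem4p6 (R : realType) (alpha : R) (q : nat) :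
  let beta := alpha / (alpha - 1) in
  let lam := if odd q then beta else beta ^+ 2 in
  special_pisot_unit alpha -> (2 <= q)%N -> alpha = beta ^+ q ->
  [/\ substitution (theta q) /\ primitive_subst (theta q),
      unimodular_subst (theta q),
      pisot_subst R (theta q),
      dominant_root (theta q) lam &
      forall (r s : nat) (c : Kspace R r s) (F : set (Kspace R r s))
        (r' s' : nat) (c' : Kspace R r' s') (nu : 'rV[R]_(theta_max q).+1)
        (Rz : 'I_(theta_max q).+1 -> set (Kspace R r' s')),
      conjugate_system alpha c -> tent_tile alpha c F ->
      conjugate_system lam c' -> left_PF_vector (theta q) lam nu ->
      rauzy_fractal (theta q) lam c' nu Rz ->
      exists2 Phi : {linear Kspace R r s -> Kspace R r' s'}, bijective Phi &
        forall k : 'I_(theta_max q).+1,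
          Rz k = Phi @` tile alpha c F q k].
Proof.
move=> beta lam special q2 abq.
have b1 : 1 < beta := special_beta_gt1 special.
have bq : beta ^+ q = beta ^+ (q - 1) + 1 := special_beta_rec special abq q2.
have dom : dominant_root (theta q) lam := dominant_root_theta q2 b1 bq.
have pl : pisot lam := special_lam_pisot special abq.
split=> //.
- split; first exact: substitution_theta.
  case: (boolP (odd q)) => oq; first exact: primitive_theta_odd.
  exact: primitive_theta_even.
- exact: unimodular_theta.
- by exists lam.
move=> r s c F r' s' c' nu Rz cs tent cs' PF RE.
have alga := special_alpha_algebraic special.
have algl : algebraic lam := algebraic_integer_algebraic (special_lam_integer q special).
have [A alphaA] := special_alpha_field abq.
have beta_field := special_beta_field alga (numfield_id alpha).
have [B lamB] : number_field alpha lam.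
  by rewrite /lam; case: ifP => _ //; exact: numfieldX.
have tiles := rauzy_fractal_tiles q2 alga b1 abq bq alphaA lamB beta_field
  cs tent cs' PF.
have [c1 c2] := conjugate_system_lt1 special abq cs'.
have lin := rauzy_iso_linear alga alphaA lamB nu cs cs'.
pose linB := GRing.isLinear.Build R _ _ *:%R _ lin.
pose Phi : {linear Kspace R r s -> Kspace R r' s'} :=
  HB.pack (rauzy_iso alpha A c c' nu) linB.
exists Phi.
  exact: (rauzy_iso_bij alga algl alphaA lamB cs cs' PF).
by move=> k; rewrite (rauzy_fractal_unique c1 c2 RE tiles).
Qed.
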